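(* Let $\bar d=(d_j)_{j\ge 0}$ be integers with $d_0=1$ and $d_j\ge 2$ for $j\ge 1$, and let $\bar p=(p_j)_{j\ge 1}$ with $p_j\in(0,1]$. For every $\Omega\in\{c_0,\ c,\ l^\alpha,\ 1\le\alpha<\infty\}$, we have $\sigma(\Omega,\bar d,\bar p)=E_{\bar d,\bar p}$.
   Context: $\mathbb{Z}_+=\{0,1,2,\dots\}$. Put $q_j=d_0d_1\cdots d_j$ for $j\ge 0$. Every $n\in\mathbb{Z}_+$ has a unique expansion $n=\sum_{j\ge1}a_j(n)q_{j-1}$ with digits $a_j(n)\in\{0,\dots,d_j-1\}$, only finitely many nonzero. Put $\zeta_n=\min\{j\ge1: a_j(n)\ne d_j-1\}$. Let $S=[s(n,m)]_{n,m\ge0}$ be the stochastic matrix with entries: $s(n,n+1)=\prod_{j=1}^{\zeta_n}p_j$; $s(n,n)=1-p_1$; if $\zeta_n\ge2$, for $1\le r\le\zeta_n-1$, $s\big(n,\,n-\sum_{j=1}^r(d_j-1)q_{j-1}\big)=(1-p_{r+1})\prod_{j=1}^rp_j$; and $s(n,m)=0$ otherwise. Column sums of $S$ are at most $1$, and $(Sw)(n)=\sum_m s(n,m)w(m)$ defines a bounded linear operator on each of the complex sequence spaces (indexed by $\mathbb{Z}_+$) $l^\alpha$ ($1\le\alpha<\infty$), $c$ (convergent sequences, sup norm), $c_0$ (sequences tending to $0$, sup norm). $\sigma(\Omega,\bar d,\bar p)$ denotes the spectrum of $S$ acting on $\Omega$. For $j\ge1$ let $f_j(z)=\left(\frac{z-(1-p_j)}{p_j}\right)^{d_j}$,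 $z\in\mathbb{C}$, and $\tilde f_j=f_j\circ\cdots\circ f_1$. Put $E_{\bar d,\bar p}=\{z\in\mathbb{C}:\limsup_{j\to\infty}|\tilde f_j(z)|<+\infty\}$. *)

(* Defs.v *)
(* Complex numbers are [R[i]] over an arbitrary
   [R : realType], with the topology of [R[i]^o], which is
   the one induced by the modulus. *)
From HB Require Import structures.
From mathcomp Require Import all_boot all_order all_algebra.
From mathcomp Require Import complex.
From mathcomp Require Import all_classical all_reals all_analysis.

Set Implicit Arguments.
Unset Strict Implicit.
Unset Printing Implicit Defensive.

Import Order.TTheory GRing.Theory Num.Theory.
Import numFieldNormedType.Exports.

Local Open Scope classical_set_scope.
Local Open Scope ring_scope.
Local Open Scope complex_scope.

Definition cmod {R : realType} (z : R[i]) : R := ComplexField.Normc.normc z.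

Lemma cmodE (R : realType) (z : R[i]) : (cmod z)%:C = `|z|.
Proof. by case: z. Qed.

Section CantorOdometer.
Local Open Scope nat_scope.

Definition q (d : nat -> nat) (j : nat) : nat := \prod_(0 <= i < j.+1) d i.

(* The digit of index j >= 1; see [digit_lt] and [digit_expansion]. *)
Definition digit (d : nat -> nat) (n j : nat) : nat := (n %/ q d j.-1) %% d j.

(* The least j >= 1 with digit d n j <> d j - 1. Searching 1 <= j <= n.+1 is
   enough, because the digit of index n.+1 is 0; see [zeta_correct]. *)
Definition zeta (d : nat -> nat) (n : nat) : nat :=
  (find (fun i => digit d n i.+1 != (d i.+1).-1) (iota 0 n.+1)).+1.

(* n minus the contribution of its first r digits, when those are maximal. *)
Definition reset (d : nat -> nat) (n r : nat) : nat :=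
  n - \sum_(1 <= j < r.+1) (d j).-1 * q d j.-1.

Lemma qS d j : q d j.+1 = q d j * d j.+1.
Proof. by rewrite /q big_nat_recr. Qed.

Section Facts.
Variables (d : nat -> nat).
Hypotheses (d0 : d 0 = 1) (d2 : forall j, 1 <= j -> 2 <= d j).

Lemma q0 : q d 0 = 1.
Proof. by rewrite /q big_nat1. Qed.

Lemma q_gt j : j < q d j.
Proof.
elim: j => [|j IH]; first by rewrite q0.
have qj : 0 < q d j by apply: leq_ltn_trans IH.
by rewrite qS (leq_ltn_trans IH) // ltn_Pmulr // d2.
Qed.

Lemma q_gt0 j : 0 < q d j.
Proof. exact: leq_ltn_trans (q_gt j). Qed.

Lemma digit_lt n j : 1 <= j -> digit d n j < d j.
Proof. by move=> /d2 dj; rewrite ltn_mod (leq_trans _ dj). Qed.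

Lemma digit_partial n k :
  n %% q d k = \sum_(1 <= j < k.+1) digit d n j * q d j.-1.
Proof.
elim: k => [|k IH]; first by rewrite q0 modn1 big_geq.
rewrite big_nat_recr //= -IH /digit /= qS.
rewrite {1}(divn_eq n (q d k)) {1}(divn_eq (n %/ q d k) (d k.+1)).
rewrite mulnDl -addnA -mulnA [d k.+1 * _]mulnC modnMDl addnC modn_small //.
rewrite (leq_trans (n := (n %/ q d k %% d k.+1).+1 * q d k)) //.
  by rewrite mulSn ltn_add2r ltn_mod q_gt0.
by rewrite mulnC leq_mul2l digit_lt ?orbT.
Qed.

Lemma digit_expansion n :
  n = \sum_(1 <= j < n.+1) digit d n j * q d j.-1.
Proof. by rewrite -digit_partial modn_small ?q_gt. Qed.

Lemma zeta_correct n :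
  [/\ 1 <= zeta d n, digit d n (zeta d n) <> (d (zeta d n)).-1
    & forall j, 1 <= j < zeta d n -> digit d n j = (d j).-1].
Proof.
pose P i := digit d n i.+1 != (d i.+1).-1.
have hasP : has P (iota 0 n.+1).
  apply/hasP; exists n; first by rewrite mem_iota add0n leqnn.
  rewrite /P /digit /= divn_small ?q_gt // mod0n.
  by have := d2 (ltn0Sn n); case: (d n.+1) => [//|[//|]].
have fP : find P (iota 0 n.+1) < n.+1 by rewrite -{2}[n.+1](size_iota 0) -has_find.
split=> //.
  by apply/eqP; have := nth_find 0 hasP; rewrite nth_iota // add0n.
move=> [//|j] /= jz; have jf : j < find P (iota 0 n.+1) by exact: jz.
have := before_find 0 jf; rewrite nth_iota; first by move=> /negbFE/eqP.
exact: ltn_trans jf fP.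
Qed.

Lemma max_digits_sum r :
  (\sum_(1 <= j < r.+1) (d j).-1 * q d j.-1).+1 = q d r.
Proof.
elim: r => [|r IH]; first by rewrite q0 big_geq.
rewrite big_nat_recr //= -addSn IH qS -mulSn prednK 1?mulnC //.
by rewrite (leq_trans _ (d2 (ltn0Sn r))).
Qed.

Lemma reset_le n r : r < zeta d n ->
  \sum_(1 <= j < r.+1) (d j).-1 * q d j.-1 <= n.
Proof.
move=> rz; have [_ _ zP] := zeta_correct n.
suff -> : \sum_(1 <= j < r.+1) (d j).-1 * q d j.-1 = n %% q d r.
  exact: leq_mod.
rewrite digit_partial; apply: eq_big_nat => j /andP[j1 jr].
by rewrite zP // j1 (leq_trans jr).
Qed.

Lemma reset_inj n r r' : r < zeta d n -> r' < zeta d n ->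
  reset d n r = reset d n r' -> r = r'.
Proof.
have q_lt a b : a < b -> q d a < q d b.
  elim: b => // b IH; rewrite ltnS leq_eqVlt => ab.
  have qb : q d b < q d b.+1.
    rewrite qS -[X in X < _]muln1 ltn_mul2l q_gt0 /=; exact: d2.
  by case/orP: ab => [/eqP->//|/IH/ltn_trans]; apply.
move=> rz rz' /eqP; rewrite /reset eqn_sub2lE ?reset_le //.
rewrite -eqSS !max_digits_sum.
by case: (ltngtP r r') => // /q_lt h /eqP e; rewrite e ltnn in h.
Qed.

End Facts.
End CantorOdometer.

Section StochasticMachine.
Context {R : realType}.
Implicit Types (d : nat -> nat) (p : nat -> R) (w : nat -> R[i]) (z : R[i]).

(* The targets reset d n r, 1 <= r < zeta d n, are pairwise distinct and
   different from n and n.+1, so the last sum has at most one term; see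
   [s_reset]. *)
Definition s d p (n m : nat) : R :=
  if m == n.+1 then \prod_(1 <= j < (zeta d n).+1) p j
  else if m == n then 1 - p 1%N
  else \sum_(1 <= r < zeta d n | m == reset d n r)
         (1 - p r.+1) * \prod_(1 <= j < r.+1) p j.

Lemma s_reset d p n r :
  d 0%N = 1%N -> (forall j, (1 <= j)%N -> (2 <= d j)%N) ->
  (1 <= r < zeta d n)%N ->
  s d p n (reset d n r) = (1 - p r.+1) * \prod_(1 <= j < r.+1) p j.
Proof.
move=> d0 d2 /andP[r1 rz]; rewrite /s.
have resetn : reset d n 0 = n by rewrite /reset big_geq // subn0.
have -> : reset d n r == n.+1 = false.
  by apply/negbTE; rewrite neq_ltn ltnS leq_subr.
have -> : reset d n r == n = false.
  apply/negbTE/eqP => e.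
  have z0 : (0 < zeta d n)%N by [].
  have := reset_inj d0 d2 rz z0 (etrans e (esym resetn)).
  by move=> r0; rewrite r0 in r1.
rewrite big_mkcond (bigD1_seq r) ?iota_uniq ?mem_index_iota ?r1 //= eqxx.
rewrite [X in _ + X]big1_seq ?addr0 // => i; rewrite mem_index_iota.
move=> /andP[ir /andP[_ iz]]; case: eqP => // e.
by rewrite (reset_inj d0 d2 rz iz e) eqxx in ir.
Qed.

Definition S_op d p (w : nat -> R[i]) (n : nat) : R[i] :=
  limn (series (fun m => (s d p n m)%:C * w m) : nat -> R[i]^o).

Lemma S_opE d p w n :
  S_op d p w n = \sum_(0 <= m < n.+2) (s d p n m)%:C * w m.
Proof.
apply/(@cvg_lim R[i]^o); first exact: norm_hausdorff.
apply: cvg_near_cst; exists n.+2 => // k /= hk.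
rewrite /series /= (big_cat_nat _ (n := n.+2)) //=.
rewrite [X in _ + X]big1_seq ?addr0 // => i.
rewrite mem_index_iota => /= /andP[hi _].
rewrite /s !gtn_eqF ?(leq_trans _ hi) // big1 ?mul0r // => r /eqP e.
by move: hi; rewrite e ltnNge /reset (leq_trans (leq_subr _ _)) // ltnW.
Qed.

(* A normed sequence space is given by its underlying set V of sequences
   and its norm N, which only matters on V. *)
Definition bounded_linear_on (V : set (nat -> R[i]))
    (N : (nat -> R[i]) -> \bar R)
    (T : (nat -> R[i]) -> (nat -> R[i])) : Prop :=
  [/\ forall w, V w -> V (T w),
      forall (a : R[i]) w w', V w -> V w' ->
        T (fun n => a * w n + w' n) = (fun n => a * T w n + T w' n)
    & exists M : R, forall w, V w -> (N (T w) <= M%:E * N w)%E].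

Definition spectrum (V : set (nat -> R[i])) (N : (nat -> R[i]) -> \bar R)
    (A : (nat -> R[i]) -> (nat -> R[i])) : set R[i] :=
  [set z | ~ exists T, bounded_linear_on V N T /\
     forall w, V w -> T (fun n => A w n - z * w n) = w
                   /\ (fun n => A (T w) n - z * T w n) = w].

Definition sup_norm w : \bar R := ereal_sup (range (fun n => (cmod (w n))%:E)).

Definition c_seq : set (nat -> R[i]) := 
  [set w | cvgn (w : nat -> R[i]^o)].

Definition c0_seq : set (nat -> R[i]) := 
  [set w | (w : nat -> R[i]^o) @ \oo --> (0 : R[i]^o)].

(* The counting measure turns the L^alpha norm into
   (\sum_n |w n| `^ alpha) `^ alpha^-1; see [l_normE]. *)
Definition l_norm (alpha : R) w : \bar R :=
  Lnorm counting alpha%:E (fun n => (cmod (w n))%:E).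

Definition l_seq (alpha : R) : set (nat -> R[i]) :=
  [set w | (l_norm alpha w < +oo)%E].

Lemma l_normE (alpha : R) w : 0 < alpha ->
  l_norm alpha w =
    ((\sum_(k <oo) (cmod (w k) `^ alpha)%:E) `^ alpha^-1)%E.
Proof.
move=> a0; rewrite /l_norm Lnorm_counting //; congr (_ `^ _)%E.
apply: eq_eseriesr => k _ /=.
by rewrite ger0_norm // /cmod; case: (w k) => a b; exact: sqrtr_ge0.
Qed.

Definition f d p (j : nat) z : R[i] :=
  ((z - (1 - p j)%:C) / (p j)%:C) ^+ d j.

(* ftilde d p j = f_j \o ... \o f_1, extended by the identity at j = 0. *)
Fixpoint ftilde d p (j : nat) z : R[i] :=
  if j is k.+1 then f d p k.+1 (ftilde d p k z) else z.

Definition E d p : set R[i] :=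
  [set z | (limn_esup (fun j => (cmod (ftilde d p j z))%:E) < +oo)%E].

End StochasticMachine.

(* Main.v *)
Require Import Defs.
From mathcomp Require Import all_boot all_order all_algebra.
From mathcomp Require Import complex.
From mathcomp Require Import all_classical all_reals all_analysis.
From mathcomp Require Import ring lra zify.
Import Order.TTheory GRing.Theory Num.Theory.
Import numFieldNormedType.Exports.
Local Open Scope ring_scope.
Local Open Scope complex_scope.

Set Implicit Arguments.
Unset Strict Implicit.
Unset Printing Implicit Defensive.

(** Write [P_r = p_1 ... p_r] and let [S'] be the operator of the shifted
    sequences [(d_2, d_3, ...)], [(p_2, p_3, ...)]. Splitting a sequence into its
    residues [w_0, ..., w_(d_1 - 1)] modulo [d_1], one has
    [S = (1 - p_1) + p_1 A] with [A (w_0, ..., w_(d_1 - 1)) = (w_1, ..., S' w_0)].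
    Hence, with [a = (z - (1 - p_1)) / p_1], the equation [(A - a) x = y] reduces to
    [(S' - a ^ d_1) x_0 = sum_j a ^ (d_1 - 1 - j) y_j], and [a ^ d_1 = f_1 z]: [S - z]
    is invertible as soon as [S' - f_1 z] is.

    If [z] is not in [E], then some [ftilde_j z] has modulus greater than 1. Since [S]
    is a convex combination of compositions with injective maps of the indices, it
    is a contraction of each space, so a Neumann series inverts the [j]-th shift of
    [S] minus [ftilde_j z], and [j] applications of the reduction invert [S - z].
    The space [c] is reduced to [c_0] by subtracting the limit.

    If [z] is in [E], all the [ftilde_j z] lie in the closed unit disk. Let [v] solve
    [S v = z v], [v 0 = 1]; the reduction gives [|v (q_k)| <= 1]. The restriction [v_k]
    of [v] to the indices below [q_k] satisfies
    [(S - z) v_k = c_k delta_(q_k - 1) + sum_(r > k) (P_r - P_(r+1)) delta_(q_r - 1)]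
    with [|c_k| <= 1]. In [l^alpha] these images have norm at most 2, so a bounded
    inverse would bound the [v_k], putting the eigenvector [v] in [l^alpha]. In [c_0]
    and [c] the averages of the [v_k] have value 1 at 0 while their images tend to 0
    in the sup norm. *)

(** * The odometer and the shift of the digits *)

(** Adds 1 to the first [r] digits of [n] and drops the carry into digit [r + 1]. *)
Definition carry (d : nat -> nat) (r n : nat) : nat :=
  if (q d r %| n.+1)%N then (n.+1 - q d r)%N else n.+1.

(** The values of the two branches are told apart by divisibility by [q d r], and each branch is
    injective. Injectivity lets composition with [carry d r] preserve the balls, those of l^alpha
    included. *)
Lemma carry_inj d r : injective (carry d r).
Proof.
rewrite /carry => m n; case: ifP => hm; case: ifP => hn //.
- move=> e; apply: succn_inj.
  by rewrite -(subnK (dvdn_leq (ltn0Sn m) hm)) e subnK // (dvdn_leq _ hn).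
- by move=> e; rewrite -e dvdn_sub // in hn.
- by move=> e; rewrite e dvdn_sub // in hm.
- by case.
Qed.

(** The value at 0 is set to 1, so that the shifted sequence satisfies the same hypotheses as
    [d]. *)
Definition dshift (d : nat -> nat) (j : nat) : nat :=
  if j is _.+1 then d j.+1 else 1%N.

Lemma dshift_ge2 d : (forall j, (1 <= j)%N -> (2 <= d j)%N) ->
  forall j, (1 <= j)%N -> (2 <= dshift d j)%N.
Proof. by move=> d2 [//|j] _; exact: d2. Qed.

Section Odometer.
Variable d : nat -> nat.
Hypotheses (d0 : d 0%N = 1%N) (d2 : forall j, (1 <= j)%N -> (2 <= d j)%N).

Lemma q_dshift r : q d r.+1 = (d 1 * q (dshift d) r)%N.
Proof.
elim: r => [|r IH]; first by rewrite qS !q0 // muln1 mul1n.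
by rewrite qS IH qS -mulnA.
Qed.

Lemma dvdn_q j k : (j <= k)%N -> (q d j %| q d k)%N.
Proof.
move=> /subnK <-; elim: (k - j)%N => // i IH.
by rewrite addSn qS dvdn_mulr.
Qed.

Lemma ltn_q j k : (j < k)%N -> (q d j < q d k)%N.
Proof.
move=> jk; apply: (leq_trans _ (dvdn_leq (q_gt0 d0 d2 k) (dvdn_q jk))).
by rewrite qS ltn_Pmulr ?d2 ?q_gt0.
Qed.

Lemma q_inj j k : q d j = q d k -> j = k.
Proof. by case: (ltngtP j k) => // /ltn_q; lia. Qed.

(** The first [r] digits of [n] are all maximal exactly when [n] is [q d r - 1] modulo [q d r]. The
    search for a digit thus becomes a question of divisibility. *)
Lemma ltn_zeta n r : (r < zeta d n)%N = (q d r %| n.+1)%N.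
Proof.
have [z1 zN zM] := zeta_correct d0 d2 n.
apply/idP/idP => [rz|].
  suff: (n %% q d r).+1 = q d r.
    by move=> e; rewrite (divn_eq n (q d r)) -addnS e dvdn_addl ?dvdn_mull.
  rewrite -{2}(max_digits_sum d0 d2 r) digit_partial //; congr _.+1.
  apply: eq_big_nat => j /andP[j1 jr].
  by rewrite zM // j1 (leq_trans jr).
(* Otherwise [q d (zeta d n)] divides [n.+1], which forces the digit of index [zeta d n] to be
   maximal. *)
move=> qr; rewrite ltnNge; apply/negP => zr; apply: zN.
have := dvdn_trans (dvdn_q zr) qr; move: z1; case: (zeta d n) => // k _.
rewrite qS /digit /= => /dvdnP[c].
have dk : (0 < d k.+1)%N by rewrite (leq_trans _ (d2 (ltn0Sn k))).
have qk := q_gt0 d0 d2 k.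
case: c => [//|c]; move: dk qk; case: (d k.+1) => // D _; case: (q d k) => // Q _ e.
have -> : n = ((c * D.+1 + D) * Q.+1 + Q)%N by lia.
by rewrite divnMDl // [(Q %/ _)%N]divn_small // addn0 modnMDl modn_small.
Qed.

Lemma reset_carry n r : (r < zeta d n)%N -> reset d n r = carry d r n.
Proof.
move=> rz; by rewrite /carry -ltn_zeta rz -(max_digits_sum d0 d2) subSS.
Qed.

Lemma carry_ge_zeta n r : (zeta d n <= r)%N -> carry d r n = n.+1.
Proof. by rewrite /carry -ltn_zeta ltnNge => ->. Qed.

(** A maximal first digit returns to 0 and passes the carry to the other digits, which form the
    odometer of [dshift d]. *)
Lemma carry_dshift m r :
  carry d r.+1 (d 1 * m + (d 1).-1) = (d 1 * carry (dshift d) r m)%N.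
Proof.
have dk : (0 < d 1)%N by rewrite (leq_trans _ (d2 _)).
rewrite /carry -addnS prednK // -mulnSr q_dshift dvdn_pmul2l //.
by case: ifP; rewrite ?mulnBr.
Qed.

Lemma carry_dshift_lt m i r : (i.+1 < d 1)%N ->
  carry d r.+1 (d 1 * m + i) = (d 1 * m + i).+1.
Proof.
move=> id; rewrite /carry q_dshift; case: ifP => // h.
have : (d 1 %| (d 1 * m + i).+1)%N by apply: dvdn_trans h; apply: dvdn_mulr.
by rewrite -addnS dvdn_addr ?dvdn_mulr // gtnNdvd.
Qed.

End Odometer.

(** * The stochastic matrix as a mixture of carry maps *)

Section Stochastic.
Context {R : realType}.
Implicit Types (p : nat -> R) (w : nat -> R[i]).

(** Probabilities that the carry passes the first [r] digits, and that it stops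
    right after them. *)
Definition reach p (r : nat) : R := \prod_(1 <= j < r.+1) p j.
Definition halt p (r : nat) : R := (1 - p r.+1) * reach p r.
Definition pshift p (j : nat) : R := p j.+1.

Lemma reach0 p : reach p 0 = 1.
Proof. by rewrite /reach big_geq. Qed.

Lemma reachS p r : reach p r.+1 = reach p r * p r.+1.
Proof. by rewrite /reach big_nat_recr. Qed.

Lemma haltE p r : halt p r = reach p r - reach p r.+1.
Proof. by rewrite /halt reachS mulrBl mul1r [p _ * _]mulrC. Qed.

Lemma sum_halt p a b : (a <= b)%N ->
  \sum_(a <= r < b) halt p r = reach p a - reach p b.
Proof.
move=> ab; rewrite -opprB -(telescope_sumr (reach p) ab) -sumrN.
by apply: eq_bigr => r _; rewrite haltE opprB.
Qed.

Lemma reach_shift p r : reach p r.+1 = p 1%N * reach (pshift p) r.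
Proof.
elim: r => [|r IH]; first by rewrite reachS !reach0 mul1r mulr1.
by rewrite reachS IH [in RHS]reachS mulrA.
Qed.

Lemma halt_shift p r : halt p r.+1 = p 1%N * halt (pshift p) r.
Proof. by rewrite /halt reach_shift mulrCA. Qed.

Section Bounds.
Variable p : nat -> R.
Hypothesis p01 : forall j, (1 <= j)%N -> 0 < p j <= 1.

Lemma reach_gt0 r : 0 < reach p r.
Proof.
elim: r => [|r IH]; first by rewrite reach0.
by rewrite reachS mulr_gt0 //; have /andP[] := p01 (ltn0Sn r).
Qed.

Lemma halt_ge0 r : 0 <= halt p r.
Proof.
have /andP[_ p1] := p01 (ltn0Sn r).
by rewrite /halt mulr_ge0 ?subr_ge0 // ltW // reach_gt0.
Qed.

Lemma reach_le1 r : reach p r <= 1.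
Proof.
elim: r => [|r IH]; first by rewrite reach0.
by apply: le_trans IH; rewrite -subr_ge0 -haltE halt_ge0.
Qed.

End Bounds.

Variable d : nat -> nat.
Hypotheses (d0 : d 0%N = 1%N) (d2 : forall j, (1 <= j)%N -> (2 <= d j)%N).

Lemma s_succ p n : s d p n n.+1 = reach p (zeta d n).
Proof. by rewrite /s eqxx. Qed.

(** The diagonal entry joins the reset entries as the term [r = 0]: [carry d 0] is the identity and
    [halt p 0] equals [1 - p 1]. *)
Lemma s_le p n m : (m <= n)%N ->
  s d p n m = \sum_(0 <= r < zeta d n) (m == carry d r n)%:R * halt p r.
Proof.
move=> mn; rewrite /s ltn_eqF ?ltnS //.
have [z1 _ _] := zeta_correct d0 d2 n.
have c0 : carry d 0 n = n by rewrite /carry q0 // dvd1n subn1.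
rewrite [RHS]big_ltn // c0; case: eqP => [->|mn'].
  rewrite mul1r /halt reach0 mulr1 big_nat big1 ?addr0 // => r /andP[r1 rz].
  case: eqP; rewrite ?mul0r // -{1}c0 -!reset_carry // => e.
  by rewrite -(reset_inj d0 d2 z1 rz e) in r1.
rewrite mul0r add0r big_mkcond /=; apply: eq_big_nat => r /andP[r1 rz].
by rewrite reset_carry //; case: eqP; rewrite (mul1r, mul0r).
Qed.

(** From [zeta d n] on, every carry map sends [n] to [n.+1] and the weights [halt p r] telescope, so
    the cut-off [K] is free. The weights and maps do not depend on [n]. *)
Lemma S_op_carry p w n K : (zeta d n <= K)%N ->
  S_op d p w n = \sum_(0 <= r < K) (halt p r)%:C * w (carry d r n)
                 + (reach p K)%:C * w n.+1.
Proof.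
move=> zK; rewrite S_opE big_nat_recr //= s_succ.
rewrite [in RHS](big_cat_nat _ (n := zeta d n)) //=.
rewrite [X in _ = _ + X + _](_ : _ =
    (reach p (zeta d n) - reach p K)%:C * w n.+1); last first.
  rewrite -sum_halt // rmorph_sum mulr_suml; apply: eq_big_nat => r /andP[zr _].
  by rewrite carry_ge_zeta.
rewrite -[RHS]addrA -mulrDl -rmorphD subrK; congr (_ + _).
transitivity (\sum_(0 <= m < n.+1) \sum_(0 <= r < zeta d n)
   ((m == carry d r n)%:R * halt p r)%:C * w m).
  by apply: eq_big_nat => m /andP[_ mn]; rewrite s_le // rmorph_sum mulr_suml.
rewrite exchange_big_nat /=; apply: eq_big_nat => r /andP[_ rz].
have cn : (carry d r n < n.+1)%N.
  rewrite /carry -ltn_zeta // rz ltn_subrL ltn0Sn andbT; exact: q_gt0.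
rewrite big_mkord (bigD1 (Ordinal cn)) //= eqxx mul1r big1 ?addr0 // => m.
by rewrite -val_eqE /= => /negbTE ->; rewrite mul0r mul0r.
Qed.

Lemma eq_S_op p w w' n : (forall m, (m <= n.+1)%N -> w m = w' m) ->
  S_op d p w n = S_op d p w' n.
Proof.
by move=> e; rewrite !S_opE; apply: eq_big_nat => m /andP[_ mn]; rewrite e.
Qed.

Lemma S_op_lin p a w w' n :
  S_op d p (fun n => a * w n + w' n) n = a * S_op d p w n + S_op d p w' n.
Proof.
rewrite !S_opE mulr_sumr -big_split; apply: eq_bigr => m _ /=.
by rewrite mulrDr mulrCA.
Qed.

Lemma S_op_const p (c : R[i]) n : S_op d p (fun=> c) n = c.
Proof.
rewrite (S_op_carry _ _ (leqnn _)) -mulr_suml -mulrDl -rmorph_sum -rmorphD.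
by rewrite sum_halt // subrK reach0 mul1r.
Qed.

End Stochastic.

Lemma S_op_shift (R : realType) d (p : nat -> R) (w : nat -> R[i]) m i :
  d 0%N = 1%N -> (forall j, (1 <= j)%N -> (2 <= d j)%N) -> (i < d 1%N)%N ->
  S_op d p w (d 1%N * m + i) =
    (1 - p 1%N)%:C * w (d 1%N * m + i)%N + (p 1%N)%:C *
      (if (i.+1 < d 1%N)%N then w (d 1%N * m + i.+1)%N
       else S_op (dshift d) (pshift p) (fun n => w (d 1%N * n)%N) m).
Proof.
move=> d0 d2; have e2 := dshift_ge2 d2; set n := (_ + _)%N => id.
(* One cut-off for both operators: [K.+1] for [d] at [n], [K] for [dshift d] at [m]. The term
   [r = 0] is split off and the others are [p 1] times the shifted ones. *)
pose K := maxn (zeta d n) (zeta (dshift d) m).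
have zK : (zeta d n <= K.+1)%N by rewrite ltnW // ltnS leq_maxl.
rewrite (S_op_carry d0 d2 _ _ zK) big_ltn // -addrA; congr (_ * _ + _).
- by rewrite /halt reach0 mulr1.
- by rewrite /carry q0 // dvd1n subn1.
rewrite big_add1 /= reach_shift.
under eq_bigr do rewrite halt_shift rmorphM /= -mulrA.
rewrite rmorphM /= -mulr_sumr -mulrA -mulrDr; congr (_ * _).
case: ifP => id1.
  under eq_bigr do rewrite carry_dshift_lt //.
  rewrite -mulr_suml -mulrDl -rmorph_sum -rmorphD sum_halt // subrK reach0.
  by rewrite mul1r /n addnS.
have di : i = (d 1%N).-1 by lia.
rewrite (S_op_carry (d := dshift d) erefl e2 _ _ (K := K)) ?leq_maxr //.
rewrite /n di; under eq_bigr do rewrite carry_dshift //.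
congr (_ + _ * w _); move: id; rewrite mulnSr. lia.
Qed.

(** * Balls of sequence spaces *)

Section Modulus.
Context {R : realType}.
Implicit Types (z : R[i]).

Lemma cmod_ge0 z : 0 <= cmod z.
Proof. by case: z => a b; exact: sqrtr_ge0. Qed.

Lemma cmodM z z' : cmod (z * z') = cmod z * cmod z'.
Proof. exact: ComplexField.Normc.normcM. Qed.

Lemma ler_cmodD z z' : cmod (z + z') <= cmod z + cmod z'.
Proof. exact: le_normcD. Qed.

Lemma cmodN z : cmod (- z) = cmod z.
Proof. exact: normcN. Qed.

Lemma cmodB z z' : cmod (z - z') = cmod (z' - z).
Proof. by rewrite -opprB cmodN. Qed.

Lemma cmod0 : cmod (0 : R[i]) = 0.
Proof. exact: ComplexField.Normc.normc0. Qed.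

Lemma cmod1 : cmod (1 : R[i]) = 1.
Proof. exact: ComplexField.Normc.normc1. Qed.

Lemma cmodV z : cmod z^-1 = (cmod z)^-1.
Proof. exact: ComplexField.Normc.normcV. Qed.

Lemma cmodX z n : cmod (z ^+ n) = cmod z ^+ n.
Proof.
elim: n => [|n IH]; first by rewrite !expr0 cmod1.
by rewrite !exprS cmodM IH.
Qed.

Lemma cmod_eq0 z : (cmod z == 0) = (z == 0).
Proof.
apply/eqP/eqP => [|->]; last exact: cmod0.
exact: ComplexField.Normc.eq0_normc.
Qed.

Lemma cmodR (x : R) : cmod x%:C = `|x|.
Proof. by rewrite /cmod /= expr0n addr0 sqrtr_sqr. Qed.

Lemma cmod_sum (u : nat -> R[i]) a b :
  cmod (\sum_(a <= k < b) u k) <= \sum_(a <= k < b) cmod (u k).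
Proof.
apply: (big_ind2 (fun x y => cmod x <= y)) => [|x x' y y' hx hy|//].
  by rewrite cmod0.
by rewrite (le_trans (ler_cmodD _ _)) // lerD.
Qed.

Lemma ger0_cmodR (x : R) : 0 <= x -> cmod x%:C = x.
Proof. by rewrite cmodR => /ger0_norm. Qed.

Lemma cmod_le0 z : cmod z <= 0 -> z = 0.
Proof. by move=> h; apply/eqP; rewrite -cmod_eq0 eq_le h cmod_ge0. Qed.

Lemma gt0_complexE z : 0 < z -> exists2 e : R, 0 < e & z = e%:C.
Proof.
by case: z => a b; rewrite ltcE => /andP[/eqP /= -> a0]; exists a.
Qed.

Lemma cvgc_cmodP (w : nat -> R[i]) (l : R[i]) :
  ((w : nat -> R[i]^o) @ \oo --> (l : R[i]^o))%classic <->
  forall e : R, 0 < e -> exists N, forall n, (N <= n)%N -> cmod (w n - l) <= e.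
Proof.
split=> [/cvgrPdist_le h e e0|h].
  have e0' : 0 < e%:C by rewrite ltcR.
  have [N _ hN] := h _ e0'; exists N => n Nn.
  by have := hN n Nn; rewrite /= -[`|_|]cmodE lecR cmodB.
apply/cvgrPdist_le => e /gt0_complexE[r r0 ->].
have [N hN] := h r r0; exists N => // n Nn.
by rewrite /= -[`|_|]cmodE lecR cmodB hN.
Qed.

End Modulus.

Section Ball.
Context {R : realType}.
Implicit Types (w x : nat -> R[i]).

(** [B C w] stands for: [w] belongs to the space and has norm at most [C]. *)
Record ball_space (B : R -> (nat -> R[i]) -> Prop) : Prop := BallSpace {
  nball_le : forall C w, B C w -> forall n, cmod (w n) <= C;
  nball0 : forall C, 0 <= C -> B C (fun=> 0);
  nball_delta : forall k, B 1 (fun n => (n == k)%:R);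
  nball_lin : forall a C C' w w', B C w -> B C' w' ->
    B (cmod a * C + C') (fun n => a * w n + w' n);
  nball_comp : forall C w (g : nat -> nat), injective g ->
    B C w -> B C (fun n => w (g n));
  nball_glue : forall D C w, (0 < D)%N ->
    (forall i, (i < D)%N -> B C (fun n => w (D * n + i)%N)) -> B (D%:R * C) w;
  nball_closed : forall C w,
    (forall e, 0 < e -> exists2 x, B C x & forall n, cmod (w n - x n) <= e) ->
    B C w
}.

Definition c0_ball (C : R) (w : nat -> R[i]) : Prop :=
  c0_seq w /\ forall n, cmod (w n) <= C.

Lemma c0_seqP w : c0_seq w <->
  forall e : R, 0 < e -> exists N, forall n, (N <= n)%N -> cmod (w n) <= e.
Proof.
rewrite /c0_seq /= cvgc_cmodP; split=> h e /h[N hN]; exists N => n /hN.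
  by rewrite subr0.
by rewrite subr0.
Qed.

(** Each value has at most one preimage, so raising [N] by one only requires moving [M] past one
    point. *)
Lemma injective_unbounded (g : nat -> nat) : injective g ->
  forall N, exists M, forall n, (M <= n)%N -> (N <= g n)%N.
Proof.
move=> gi; elim=> [|N [M hM]]; first by exists 0%N.
have [[m gm]|h] := pselect (exists m, g m = N).
  exists (maxn M m.+1) => n; rewrite geq_max => /andP[/hM Nn mn].
  by rewrite ltn_neqAle Nn andbT -gm; apply/eqP => /gi e; rewrite e ltnn in mn.
exists M => n /hM Nn; rewrite ltn_neqAle Nn andbT; apply/eqP => e.
by apply: h; exists n.
Qed.

Lemma c0_ball_space : ball_space c0_ball.
Proof.
split.
- by move=> C w [].
- move=> C C0; split=> [|n]; last by rewrite cmod0.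
  by apply/c0_seqP => e /ltW e0; exists 0%N => n _; rewrite cmod0.
- move=> k; split=> [|n].
    apply/c0_seqP => e /ltW e0; exists k.+1 => n kn.
    by rewrite gtn_eqF // cmod0.
  by case: eqP => _; rewrite ?cmod0 ?cmod1.
- move=> a C C' w w' [/c0_seqP w0 wC] [/c0_seqP w'0 wC']; split=> [|n].
    apply/c0_seqP => e e0.
    have a0 : 0 < cmod a + 1 by rewrite ltr_wpDl // cmod_ge0.
    have [N hN] := w0 _ (divr_gt0 (divr_gt0 e0 (ltr0Sn _ 1)) a0).
    have [N' hN'] := w'0 _ (divr_gt0 e0 (ltr0Sn _ 1)).
    exists (maxn N N') => n; rewrite geq_max => /andP[/hN h /hN' h'].
    rewrite (le_trans (ler_cmodD _ _)) // cmodM.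
    rewrite [leRHS]splitr lerD // -[leRHS](divfK (lt0r_neq0 a0)) [leRHS]mulrC.
    by rewrite ler_pM ?cmod_ge0 // ler_wpDr.
  by rewrite (le_trans (ler_cmodD _ _)) // cmodM lerD // ler_wpM2l ?cmod_ge0.
- move=> C w g gi [/c0_seqP w0 wC]; split=> // .
  apply/c0_seqP => e /w0[N hN]; have [M hM] := injective_unbounded gi N.
  by exists M => n /hM/hN.
- move=> D C w D0 h; split=> [|n].
    apply/c0_seqP => e e0.
    have hi i : exists N, (i < D)%N -> forall n, (N <= n)%N ->
        cmod (w (D * n + i)%N) <= e.
      have [iD|] := ltnP i D; last by exists 0%N.
      by have [/c0_seqP/(_ _ e0)[N hN] _] := h i iD; exists N.
    have [F hF] := choice hi.
    exists (D * \max_(i < D) F i)%N => n hn.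
    rewrite (divn_eq n D) mulnC; apply: hF; rewrite ?ltn_mod //.
    rewrite leq_divRL // mulnC (leq_trans _ hn) // leq_mul2l.
    apply/orP; right; have nD : (n %% D < D)%N by rewrite ltn_mod.
    exact: (leq_bigmax (Ordinal nD)).
  have nD : (n %% D < D)%N by rewrite ltn_mod.
  have [_ /(_ (n %/ D)%N)] := h _ nD; rewrite mulnC -divn_eq => le.
  rewrite (le_trans le) // ler_peMl ?ler1n //.
  exact: le_trans (cmod_ge0 _) le.
- move=> C w h; split=> [|n].
    apply/c0_seqP => e e0; have e2 := divr_gt0 e0 (ltr0Sn R 1).
    have [x [/c0_seqP/(_ _ e2)[N hN] _] xw] := h _ e2.
    exists N => n /hN xn; rewrite -(subrK (x n) (w n)).
    by rewrite (le_trans (ler_cmodD _ _)) // [leRHS]splitr lerD.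
  apply/ler_addgt0Pr => e /h[x [_ xC] xw]; rewrite -(subrK (x n) (w n)) addrC.
  by rewrite (le_trans (ler_cmodD _ _)) // lerD.
Qed.

End Ball.

(** * Balls of l^alpha *)

Section Powers.
Context {R : realType}.
Variable alpha : R.
Hypothesis alpha1 : 1 <= alpha.

Let alpha0 : 0 < alpha. Proof. exact: lt_le_trans ltr01 alpha1. Qed.

Lemma ler_powRV s C : 0 <= s -> 0 <= C -> (s <= C `^ alpha) = (s `^ alpha^-1 <= C).
Proof.
move=> s0 C0; have ai : 0 < alpha^-1 by rewrite invr_gt0.
have E : C = (C `^ alpha) `^ alpha^-1 by rewrite -powRrM divff ?gt_eqF // powRr1.
apply/idP/idP => h.
  by rewrite E ge0_ler_powR ?nnegrE ?powR_ge0 // ltW.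
rewrite -(powRr1 s0) -(mulVf (lt0r_neq0 alpha0)) powRrM.
by rewrite ge0_ler_powR ?nnegrE ?powR_ge0 // ltW.
Qed.

Lemma ler_pow_powR (x C : R) : 0 <= x -> 0 <= C -> x `^ alpha <= C `^ alpha -> x <= C.
Proof.
move=> x0 C0; rewrite ler_powRV ?powR_ge0 // -powRrM divff ?gt_eqF //.
by rewrite powRr1.
Qed.

Lemma ler_wpowR (x y : R) : 0 <= x -> x <= y -> x `^ alpha <= y `^ alpha.
Proof.
move=> x0 xy; rewrite ge0_ler_powR ?nnegrE ?(ltW alpha0) //.
exact: le_trans xy.
Qed.

Lemma powR_convex (t u v : R) : 0 <= t <= 1 -> 0 <= u -> 0 <= v ->
  (t * u + (1 - t) * v) `^ alpha <= t * u `^ alpha + (1 - t) * v `^ alpha.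
Proof.
move=> /andP[t0 t1] u0 v0.
by have := @convex_powR R alpha alpha1 (Itv01 t0 t1) u v; apply;
  rewrite inE /= in_itv /= ?u0 ?v0.
Qed.

Lemma sum_powR_eq0 m (x : nat -> R) : (forall n, 0 <= x n) ->
  \sum_(0 <= n < m) x n `^ alpha <= 0 -> forall n, (n < m)%N -> x n = 0.
Proof.
move=> x0 h n nm; apply: (@powR_eq0_eq0 _ _ alpha); apply/eqP.
rewrite eq_le powR_ge0 andbT (le_trans _ h) //.
rewrite big_mkord (bigD1 (Ordinal nm)) //= lerDl sumr_ge0 // => i _.
exact: powR_ge0.
Qed.

Lemma sum_powR_scale m (x : nat -> R) A c :
  (forall n, 0 <= x n) -> 0 <= A -> 0 <= c ->
  \sum_(0 <= n < m) x n `^ alpha <= A `^ alpha ->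
  \sum_(0 <= n < m) (c * x n) `^ alpha <= (c * A) `^ alpha.
Proof.
move=> x0 A0 c0 h; rewrite powRM //.
under eq_bigr do rewrite powRM //.
by rewrite -mulr_sumr ler_wpM2l // powR_ge0.
Qed.

(** Minkowski's inequality by convexity of the power: [x + y] is [A + B] times the convex
    combination of [x / A] and [y / B] with [t = A / (A + B)]. Zero radii are treated first because
    of the divisions. *)
Lemma sum_powR_minkowski m (x y : nat -> R) A B :
  (forall n, 0 <= x n) -> (forall n, 0 <= y n) -> 0 <= A -> 0 <= B ->
  \sum_(0 <= n < m) x n `^ alpha <= A `^ alpha ->
  \sum_(0 <= n < m) y n `^ alpha <= B `^ alpha ->
  \sum_(0 <= n < m) (x n + y n) `^ alpha <= (A + B) `^ alpha.
Proof.
move=> x0 y0; rewrite le_eqVlt => /orP[/eqP <- B0|A0].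
  rewrite powR0 ?gt_eqF // add0r => /(sum_powR_eq0 x0) hx hy.
  rewrite (le_trans _ hy) // le_eqVlt; apply/orP; left; apply/eqP.
  by apply: eq_big_nat => n /andP[_ nm]; rewrite hx // add0r.
rewrite le_eqVlt => /orP[/eqP <- hx|B0].
  rewrite powR0 ?gt_eqF // addr0 => /(sum_powR_eq0 y0) hy.
  rewrite (le_trans _ hx) // le_eqVlt; apply/orP; left; apply/eqP.
  by apply: eq_big_nat => n /andP[_ nm]; rewrite hy // addr0.
move=> hx hy; have AB : 0 < A + B by rewrite addr_gt0.
pose t := A / (A + B).
have t01 : 0 <= t <= 1.
  by rewrite /t ler_pdivrMr // mul1r lerDl (ltW B0) andbT divr_ge0 ?ltW.
have t1 : 1 - t = B / (A + B) by rewrite /t; field; rewrite gt_eqF.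
apply: (@le_trans _ _ (\sum_(0 <= n < m) (A + B) `^ alpha *
    (t * (A^-1 * x n) `^ alpha + (1 - t) * (B^-1 * y n) `^ alpha))).
  apply: ler_sum => n _.
  have -> : x n + y n = (A + B) * (t * (A^-1 * x n) + (1 - t) * (B^-1 * y n)).
    by rewrite t1 /t; field; rewrite !gt_eqF.
  have xA : 0 <= A^-1 * x n by rewrite mulr_ge0 // invr_ge0 ltW.
  have yB : 0 <= B^-1 * y n by rewrite mulr_ge0 // invr_ge0 ltW.
  rewrite powRM ?(ltW AB) // ?ler_wpM2l ?powR_ge0 ?powR_convex //.
  have /andP[? ?] := t01.
  by rewrite addr_ge0 // mulr_ge0 // subr_ge0.
rewrite -mulr_sumr ler_piMr ?powR_ge0 // big_split /= -!mulr_sumr.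
have Ai : 0 <= A^-1 by rewrite invr_ge0 ltW.
have Bi : 0 <= B^-1 by rewrite invr_ge0 ltW.
have := sum_powR_scale x0 (ltW A0) Ai hx; rewrite mulVf ?gt_eqF // powR1 => hx'.
have := sum_powR_scale y0 (ltW B0) Bi hy; rewrite mulVf ?gt_eqF // powR1 => hy'.
have /andP[? ?] := t01.
have E : t * 1 + (1 - t) * 1 = 1 by ring.
by rewrite -[leRHS]E lerD // ler_wpM2l // subr_ge0.
Qed.

End Powers.

Section SumReindex.
Context {R : realType}.
Implicit Type F : nat -> R.

(** The values [g n] are distinct, so the left side is a subsum of the terms of [F] below any bound
    [M] for them. *)
Lemma sum_nat_comp_le F (g : nat -> nat) m : (forall n, 0 <= F n) ->
  injective g -> exists M,
  \sum_(0 <= n < m) F (g n) <= \sum_(0 <= n < M) F n.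
Proof.
move=> F0 gi; pose r := [seq g n | n <- index_iota 0 m].
pose M := (\max_(n <- r) n).+1; exists M.
rewrite -(big_map g predT F) -/r.
have rM : perm_eq r [seq x <- index_iota 0 M | x \in r].
  apply: uniq_perm; rewrite ?filter_uniq ?iota_uniq ?map_inj_uniq ?iota_uniq //.
  move=> x; rewrite mem_filter mem_index_iota /=; case xr: (x \in r) => //=.
  by rewrite ltnS leq_bigmax_seq.
rewrite (perm_big _ rM) big_filter big_mkcond ler_sum // => n _.
by case: ifP.
Qed.

Lemma sum_nat_glue F D m :
  \sum_(0 <= n < D * m) F n = \sum_(0 <= i < D) \sum_(0 <= n < m) F (D * n + i)%N.
Proof.
elim: m => [|m IH].
  by rewrite muln0 big_geq // big1 // => i _; rewrite big_geq.
rewrite mulnSr (big_cat_nat _ (n := (D * m)%N)) ?leq_addr //= IH.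
rewrite -{1}[(D * m)%N]add0n big_addn addKn -big_split /=.
by apply: eq_bigr => i _; rewrite big_nat_recr //= addnC.
Qed.

End SumReindex.

Section LBall.
Context {R : realType}.
Variable alpha : R.
Hypothesis alpha1 : 1 <= alpha.

Let alpha0 : 0 < alpha. Proof. exact: lt_le_trans ltr01 alpha1. Qed.

(** Partial sums avoid infinite series. The sign of [C] is imposed because [powR] is nonnegative at
    every base, so the inequalities alone would allow a negative radius. *)
Definition l_ball (C : R) (w : nat -> R[i]) : Prop :=
  0 <= C /\ forall m, \sum_(0 <= n < m) cmod (w n) `^ alpha <= C `^ alpha.

Lemma l_ball_space : ball_space l_ball.
Proof.
have cp (w : nat -> R[i]) n : 0 <= cmod (w n) by exact: cmod_ge0.
split.
- move=> C w [C0 h] n; apply: (ler_pow_powR alpha1) => //.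
  rewrite (le_trans _ (h n.+1)) // big_nat_recr //= lerDr sumr_ge0 // => i _.
  exact: powR_ge0.
- move=> C C0; split=> // m; rewrite big1 ?powR_ge0 // => i _.
  by rewrite cmod0 powR0 ?gt_eqF.
- move=> k; split=> // m; rewrite powR1.
  have E n : cmod ((n == k)%:R : R[i]) `^ alpha = (n == k)%:R.
    by case: eqP => _; rewrite (cmod0, cmod1) ?powR1 ?powR0 ?gt_eqF.
  under eq_bigr do rewrite E.
  have [km|mk] := ltnP k m; last first.
    rewrite big_nat big1 // => n /andP[_ nm].
    by rewrite ltn_eqF // (leq_trans nm).
  rewrite big_mkord (bigD1 (Ordinal km)) //= eqxx big1 ?addr0 // => n.
  by rewrite -val_eqE /= => /negbTE ->.
- move=> a C C' w w' [C0 hw] [C'0 hw']; split=> [|m].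
    by rewrite addr_ge0 // mulr_ge0 // cmod_ge0.
  apply: (@le_trans _ _ (\sum_(0 <= n < m)
      (cmod a * cmod (w n) + cmod (w' n)) `^ alpha)).
    apply: ler_sum => n _; apply: (ler_wpowR alpha1 (cmod_ge0 _)).
    by rewrite -cmodM ler_cmodD.
  apply: sum_powR_minkowski => // [n||].
  + by rewrite mulr_ge0 ?cmod_ge0.
  + by rewrite mulr_ge0 ?cmod_ge0.
  + by apply: sum_powR_scale => //; exact: cmod_ge0.
- move=> C w g gi [C0 h]; split=> // m.
  have F0 n : 0 <= cmod (w n) `^ alpha by exact: powR_ge0.
  by have [M hM] := sum_nat_comp_le m F0 gi; exact: le_trans (h M).
- move=> D C w D0 h; have C0 : 0 <= C by have [] := h 0%N D0.
  split=> [|m]; first by rewrite mulr_ge0.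
  apply: (@le_trans _ _ (\sum_(0 <= n < D * m) cmod (w n) `^ alpha)).
    rewrite [leRHS](big_cat_nat _ (n := m)) ?leq_pmull //= lerDl sumr_ge0 // => n _.
    exact: powR_ge0.
  rewrite (sum_nat_glue (fun n => cmod (w n) `^ alpha)).
  apply: (@le_trans _ _ (\sum_(0 <= i < D) C `^ alpha)).
    by apply: ler_sum_nat => i /andP[_ iD]; have [_] := h i iD.
  rewrite sumr_const_nat subn0 -[leLHS]mulr_natl powRM // ler_wpM2r ?powR_ge0 //.
  by rewrite le1r_powR // ler1n.
- move=> C w h; have C0 : 0 <= C by have [x [C0 _] _] := h _ ltr01.
  split=> // m; rewrite ler_powRV ?sumr_ge0 // => [|i _]; last exact: powR_ge0.
  apply/ler_addgt0Pr => e e0.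
  have M0 : 0 < m.+1%:R :> R by [].
  have [x [_ hx] xw] := h _ (divr_gt0 e0 M0).
  rewrite -ler_powRV ?addr_ge0 ?(ltW e0) ?sumr_ge0 // => [|i _]; last first.
    exact: powR_ge0.
  apply: (@le_trans _ _ (\sum_(0 <= n < m)
      (cmod (x n) + cmod (w n - x n)) `^ alpha)).
    apply: ler_sum => n _; apply: (ler_wpowR alpha1 (cmod_ge0 _)).
    by rewrite -{1}(subrK (x n) (w n)) addrC ler_cmodD.
  apply: (sum_powR_minkowski alpha1 _ _ C0 (ltW e0) (hx m)) => // [n|];
    rewrite ?cmod_ge0 //.
  apply: (@le_trans _ _ (\sum_(0 <= n < m) (e / m.+1%:R) `^ alpha)).
    by apply: ler_sum => n _; apply: (ler_wpowR alpha1 (cmod_ge0 _)).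
  rewrite sumr_const_nat subn0 -[leLHS]mulr_natl.
  apply: (@le_trans _ _ (m.+1%:R `^ alpha * (e / m.+1%:R) `^ alpha)).
    rewrite ler_wpM2r ?powR_ge0 //.
    by rewrite (le_trans (_ : _ <= m.+1%:R)) ?ler_nat // le1r_powR // ler1n.
  rewrite -powRM //; last by rewrite divr_ge0 ?ltW.
  by rewrite mulrC divfK ?gt_eqF.
Qed.

End LBall.

(** * Series in balls *)

Section RealSeries.
Context {R : realType}.
Implicit Types a r t : nat -> R.

Lemma nondecreasing_sup t A : (forall K, t K <= t K.+1) -> (forall K, t K <= A) ->
  exists l, [/\ forall K, t K <= l, l <= A &
    forall e, 0 < e -> exists K0, forall K, (K0 <= K)%N -> l - e <= t K].
Proof.
move=> tS tA.
have tm j k : (j <= k)%N -> t j <= t k.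
  by move=> /subnK <-; elim: (k - j)%N => // i IH; rewrite (le_trans IH) ?tS.
have ne : (range t !=set0)%classic by exists (t 0%N); exists 0%N.
have hs : has_sup (range t).
  by split=> //; exists A => _ [K _ <-].
exists (sup (range t)); split.
- by move=> K; apply: sup_upper_bound => //; exists K.
- by apply: ge_sup => // _ [K _ <-].
- move=> e e0; have [_ [K0 _ <-] h] := sup_adherent e0 hs.
  by exists K0 => K /tm; apply: le_trans; exact: ltW.
Qed.

(** The partial sums of [a] and of [r + a] are nondecreasing and bounded; the sum of [r] is the
    difference of their limits. *)
Lemma dominated_series r a A : (forall k, `|r k| <= a k) ->
  (forall K, \sum_(0 <= k < K) a k <= A) ->
  exists x, forall e, 0 < e -> exists K0, forall K, (K0 <= K)%N ->
    `|x - \sum_(0 <= k < K) r k| <= e.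
Proof.
move=> ra aA; have a0 k : 0 <= a k by apply: le_trans (ra k).
have [|//|l [al _ le]] := @nondecreasing_sup (fun K => \sum_(0 <= k < K) a k) A.
  by move=> K; rewrite big_nat_recr //= lerDl.
pose t K := \sum_(0 <= k < K) (r k + a k).
have [||l' [tl' _ l'e]] := @nondecreasing_sup t (A + A).
- move=> K; rewrite /t big_nat_recr //= lerDl -lerBlDr sub0r.
  by have := ra K; rewrite ler_norml => /andP[].
- move=> K; rewrite /t big_split lerD // (le_trans _ (aA K)) // ler_sum // => k _.
  by rewrite (le_trans (ler_norm _)).
exists (l' - l) => e e0; have [K0 h0] := le e e0; have [K1 h1] := l'e e e0.
exists (maxn K0 K1) => K; rewrite geq_max => /andP[/h0 {}h0 /h1 {}h1].
have {h1} := h1; have := tl' K; have := al K; move: h0; rewrite /t big_split /=.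
by move=> ? ? ? ?; rewrite ler_norml; apply/andP; split; lra.
Qed.

Lemma dominated_series_complex (u : nat -> R[i]) a A :
  (forall k, cmod (u k) <= a k) -> (forall K, \sum_(0 <= k < K) a k <= A) ->
  exists x, forall e, 0 < e -> exists K0, forall K, (K0 <= K)%N ->
    cmod (x - \sum_(0 <= k < K) u k) <= e.
Proof.
move=> ua aA.
have Reu k : `|complex.Re (u k)| <= a k.
  by apply: le_trans (ua k); rewrite -lecR cmodE normc_ge_Re.
have Imu k : `|complex.Im (u k)| <= a k.
  apply: le_trans (ua k); case: (u k) => x y /=.
  by rewrite /cmod /= -[leLHS]sqrtr_sqr ler_wsqrtr // lerDr sqr_ge0.
have [x hx] := dominated_series Reu aA; have [y hy] := dominated_series Imu aA.
exists (x%:C + 'i * y%:C) => e e0; have e2 := divr_gt0 e0 (ltr0Sn R 1).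
have [K0 h0] := hx _ e2; have [K1 h1] := hy _ e2.
exists (maxn K0 K1) => K; rewrite geq_max => /andP[/h0 {}h0 /h1 {}h1].
have -> : \sum_(0 <= k < K) u k = (\sum_(0 <= k < K) complex.Re (u k))%:C +
    'i * (\sum_(0 <= k < K) complex.Im (u k))%:C.
  rewrite !rmorph_sum mulr_sumr -big_split; apply: eq_bigr => k _ /=.
  by rewrite -complexE.
rewrite opprD addrACA -mulrBr -!rmorphB (le_trans (ler_cmodD _ _)) // cmodM.
have -> : cmod ('i : R[i]) = 1.
  by rewrite /cmod /= expr0n add0r expr1n sqrtr1.
by rewrite mul1r !cmodR [leRHS]splitr lerD.
Qed.

End RealSeries.

Section BallTheory.
Context {R : realType}.
Variable B : R -> (nat -> R[i]) -> Prop.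
Hypothesis hB : ball_space B.
Implicit Types (w x y : nat -> R[i]).

Lemma nball_ge0 C w : B C w -> 0 <= C.
Proof. by move=> /(nball_le hB)/(_ 0%N); apply: le_trans; exact: cmod_ge0. Qed.

Lemma nball_scale a C w : B C w -> B (cmod a * C) (fun n => a * w n).
Proof.
move=> /(nball_lin hB a)/(_ (nball0 hB (lexx 0))); rewrite addr0.
by congr (B _); apply/funext => n; rewrite addr0.
Qed.

Lemma nball_add C C' w w' : B C w -> B C' w' -> B (C + C') (fun n => w n + w' n).
Proof.
move=> h /(nball_lin hB 1 h); rewrite cmod1 mul1r.
by congr (B _); apply/funext => n; rewrite mul1r.
Qed.

Lemma nball_mono C C' w : C <= C' -> B C w -> B C' w.
Proof.
rewrite -subr_ge0 => /(nball0 hB) h0 /nball_add/(_ h0); rewrite addrC subrK.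
by congr (B _); apply/funext => n; rewrite addr0.
Qed.

Lemma nball_sum (u : nat -> nat -> R[i]) a K : (forall k, B (a k) (u k)) ->
  B (\sum_(0 <= k < K) a k) (fun n => \sum_(0 <= k < K) u k n).
Proof.
move=> h; elim: K => [|K IH].
  rewrite big_geq //; have := nball0 hB (lexx 0).
  by congr (B _); apply/funext => n; rewrite big_geq.
rewrite big_nat_recr //=; have := nball_add IH (h K).
by congr (B _); apply/funext => n; rewrite big_nat_recr.
Qed.

Lemma nball_finite w N : (forall n, (N <= n)%N -> w n = 0) ->
  B (\sum_(0 <= k < N) cmod (w k)) w.
Proof.
move=> wN; have h k := nball_scale (w k) (nball_delta hB k).
have := nball_sum N h; under eq_bigr do rewrite mulr1.
congr (B _); apply/funext => n.
have [nN|Nn] := ltnP n N.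
  rewrite big_mkord (bigD1 (Ordinal nN)) //= eqxx mulr1 big1 ?addr0 // => i.
  by rewrite -val_eqE /= eq_sym => /negbTE ->; rewrite mulr0.
rewrite wN // big_nat big1 // => i /andP[_ iN].
by rewrite gtn_eqF ?mulr0 // (leq_trans iN).
Qed.

(** The series converges pointwise by domination, and the tails of [a] bound its tails uniformly in
    [n]. Closedness under uniform approximation then puts the sum in the ball. *)
Lemma nball_series (u : nat -> nat -> R[i]) a A : (forall k, B (a k) (u k)) ->
  (forall K, \sum_(0 <= k < K) a k <= A) ->
  exists2 w, B A w & forall e, 0 < e -> exists K0, forall K n, (K0 <= K)%N ->
    cmod (w n - \sum_(0 <= k < K) u k n) <= e.
Proof.
move=> hu aA; have ua n k : cmod (u k n) <= a k by exact: (nball_le hB (hu k)).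
have [w hw] := choice (fun n => dominated_series_complex (ua n) aA).
have a0 k : 0 <= a k by exact: nball_ge0 (hu k).
have unif e : 0 < e -> exists K0, forall K n, (K0 <= K)%N ->
    cmod (w n - \sum_(0 <= k < K) u k n) <= e.
  move=> e0.
  have [|//|l [al _ le]] := @nondecreasing_sup R (fun K => \sum_(0 <= k < K) a k) A.
    by move=> K; rewrite big_nat_recr //= lerDl.
  have [K0 h0] := le e e0; exists K0 => K n K0K.
  apply/ler_addgt0Pr => e' e'0; have [K1 h1] := hw n e' e'0.
  have := h1 (K + K1)%N (leq_addl _ _).
  rewrite (big_cat_nat _ (n := K)) ?leq_addr //= => h.
  set s := \sum_(0 <= k < K) u k n in h *.
  set s' := \sum_(K <= k < K + K1) u k n in h.
  have -> : w n - s = s' + (w n - (s + s')) by ring.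
  rewrite (le_trans (ler_cmodD _ _)) // lerD //.
  apply: le_trans (cmod_sum _ _ _) _.
  apply: (@le_trans _ _ (\sum_(K <= k < K + K1) a k)); first exact: ler_sum.
  have := al (K + K1)%N; have := h0 K K0K.
  rewrite [X in _ -> X <= l -> _](big_cat_nat _ (n := K)) ?leq_addr //=.
  by lra.
exists w => //; apply: (nball_closed hB) => e /unif[K hK].
exists (fun n => \sum_(0 <= k < K) u k n); last by move=> n; exact: hK.
exact: nball_mono (aA K) (nball_sum _ hu).
Qed.

End BallTheory.

(** * Contraction and Neumann series *)

Lemma cmod_small (R : realType) (z : R[i]) :
  (forall e : R, 0 < e -> cmod z <= e) -> z = 0.
Proof.
by move=> h; apply/cmod_le0/ler_addgt0Pr => e /h; rewrite add0r.
Qed.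

Lemma geometric_small (R : realType) (r C e : R) : 0 <= r < 1 -> 0 < e ->
  exists K, forall k, (K <= k)%N -> r ^+ k * C <= e.
Proof.
move=> /andP[r0 r1] e0.
have /cvgrPdist_le h : (geometric C r @ \oo --> (0 : R))%classic.
  by apply: cvg_geometric; rewrite ger0_norm.
have [K _ hK] := h e e0; exists K => k /hK /=.
by rewrite sub0r normrN /geometric /= mulrC; apply: le_trans; exact: ler_norm.
Qed.

Lemma sum_geometric_le (R : realType) (r : R) K : 0 <= r < 1 ->
  \sum_(0 <= k < K) r ^+ k.+1 <= (1 - r)^-1.
Proof.
move=> /andP[r0 r1]; have r1' : 0 < 1 - r by rewrite subr_gt0.
suff E : (1 - r) * \sum_(0 <= k < K) r ^+ k.+1 = r - r ^+ K.+1.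
  rewrite -(ler_pM2l r1') E divff ?gt_eqF // (le_trans _ (ltW r1)) //.
  by rewrite gerBl exprn_ge0.
elim: K => [|K IH]; first by rewrite big_geq // mulr0 expr1 subrr.
by rewrite big_nat_recr //= mulrDr IH [r ^+ K.+2]exprS; ring.
Qed.

Section Contraction.
Context {R : realType}.
Variables (d : nat -> nat) (p : nat -> R).
Hypotheses (d0 : d 0%N = 1%N) (d2 : forall j, (1 <= j)%N -> (2 <= d j)%N).
Hypothesis p01 : forall j, (1 <= j)%N -> 0 < p j <= 1.
Variable B : R -> (nat -> R[i]) -> Prop.
Hypothesis hB : ball_space B.

(** With [l] the limit of [reach p], [S] is the sum of the [halt p k] times composition with
    [carry d k], plus [l] times composition with the successor. The weights sum to
    [(1 - l) + l = 1]. *)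
Lemma nball_S_op C w : B C w -> B C (S_op d p w).
Proof.
move=> hw; have C0 := nball_ge0 hB hw.
have [K||l' [lr' _ l'e]] := @nondecreasing_sup R (fun K => - reach p K) 0.
- by rewrite lerN2 -subr_ge0 -haltE halt_ge0.
- by move=> K; rewrite oppr_le0 ltW // reach_gt0.
pose l := - l'; have lr K : l <= reach p K by rewrite lerNl.
have l1 : l <= 1 by have := lr 0%N; rewrite reach0.
have l0 : 0 <= l.
  apply/ler_addgt0Pr => e e0; have [K hK] := l'e e e0.
  by have := hK K (leqnn _); have := reach_gt0 p01 K; rewrite /l; lra.
have hu k : B (halt p k * C) (fun n => (halt p k)%:C * w (carry d k n)).
  have := nball_scale hB (halt p k)%:C (nball_comp hB (@carry_inj d k) hw).
  by rewrite ger0_cmodR // halt_ge0.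
have hs K : \sum_(0 <= k < K) halt p k * C <= (1 - l) * C.
  by rewrite -mulr_suml sum_halt // reach0 ler_wpM2r // lerB.
have [w' hw' hw'S] := nball_series hB hu hs.
have := nball_lin hB l%:C (nball_comp hB succn_inj hw) hw'.
rewrite ger0_cmodR // -mulrDl addrC subrK mul1r; congr (B _).
apply/funext => n; apply/subr0_eq/cmod_small => e e0.
have e2 := divr_gt0 e0 (ltr0Sn R 1).
have C1 : 0 < C + 1 by rewrite ltr_wpDl.
have [K1 h1] := hw'S _ e2; have [K2 h2] := l'e _ (divr_gt0 e2 C1).
(* Beyond [zeta d n] the finite formula for row [n] applies; it differs from the series by a tail
   and by [reach p K - l] times [w n.+1]. *)
pose K := (zeta d n + (K1 + K2))%N.
rewrite (S_op_carry d0 d2 p w (leq_addr (K1 + K2) (zeta d n))) -/K.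
set s := \sum_(_ <= _ < _) _.
have -> : l%:C * w n.+1 + w' n - (s + (reach p K)%:C * w n.+1) =
  (w' n - s) - (reach p K - l)%:C * w n.+1 by rewrite rmorphB; ring.
rewrite (le_trans (ler_cmodD _ _)) // [leRHS]splitr lerD //.
  by apply: h1; rewrite /K; lia.
have rl : 0 <= reach p K - l by rewrite subr_ge0.
rewrite cmodN cmodM ger0_cmodR // -[leRHS](divfK (lt0r_neq0 C1)).
rewrite ler_pM ?cmod_ge0 //.
  have := h2 K; rewrite /l => /(_ _); rewrite /K => h.
  by have := h (ltac:(lia)); rewrite -/K; lra.
by rewrite (le_trans (nball_le hB hw _)) // lerDl.
Qed.

(** Membership in a space is not assumed: this serves the remainders of the Neumann series, known
    only to be uniformly small, and the space [c]. *)
Lemma cmod_S_op_le w (e : R) n :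
  (forall m, cmod (w m) <= e) -> cmod (S_op d p w n) <= e.
Proof.
move=> we; have e0 : 0 <= e by apply: le_trans (we 0%N); exact: cmod_ge0.
rewrite (S_op_carry d0 d2 _ _ (leqnn _)) (le_trans (ler_cmodD _ _)) //.
have -> : e = (1 - reach p (zeta d n)) * e + reach p (zeta d n) * e.
  by rewrite -mulrDl subrK mul1r.
have rp := reach_gt0 p01; have hp := halt_ge0 p01.
rewrite lerD //; last first.
  by rewrite cmodM ger0_cmodR ?(ltW (rp _)) // ler_wpM2l // ltW.
rewrite (le_trans (cmod_sum _ _ _)) // -[1](reach0 p) -sum_halt // mulr_suml.
by apply: ler_sum => r _; rewrite cmodM ger0_cmodR // ler_wpM2l.
Qed.

Lemma nball_iter_S_op k C w : B C w -> B C (iter k (S_op d p) w).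
Proof. by move=> hw; elim: k => // k IH; exact: nball_S_op. Qed.

(** Invertibility of [S - z] in terms of balls: bounded solvability and injectivity. No inverse map
    is chosen, which eases the passage from the shifted operator. *)
Definition invertible_at z := exists2 M, 0 <= M &
  (forall C y, B C y -> exists2 x, B (M * C) x &
     forall n, S_op d p x n - z * x n = y n) /\
  (forall C x, B C x -> (forall n, S_op d p x n = z * x n) -> forall n, x n = 0).

(** The solution is the Neumann series of terms [- z^-1 ^+ k.+1] times [S^k y]. For injectivity,
    [S x = z x] makes the contraction shrink the radius of [x] by [r] at each step. *)
Lemma invertible_at_gt1 z : 1 < cmod z -> invertible_at z.
Proof.
move=> z1; have z0 : 0 < cmod z by apply: lt_trans z1.
have zN0 : z != 0 by rewrite -cmod_eq0 gt_eqF.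
pose r := (cmod z)^-1.
have r0 : 0 < r by rewrite invr_gt0.
have r1 : r < 1 by rewrite invf_lt1.
have r01 : 0 <= r < 1 by rewrite ltW.
have s0 : 0 <= (1 - r)^-1 by rewrite invr_ge0 subr_ge0 ltW.
exists (1 - r)^-1 => //; split=> [C y hy|C x hx xz n].
  have C0 := nball_ge0 hB hy.
  pose u k n := - z^-1 ^+ k.+1 * iter k (S_op d p) y n.
  have hu k : B (r ^+ k.+1 * C) (u k).
    have := nball_scale hB (- z^-1 ^+ k.+1) (nball_iter_S_op k hy).
    by rewrite cmodN cmodX cmodV.
  have hs K : \sum_(0 <= k < K) r ^+ k.+1 * C <= (1 - r)^-1 * C.
    by rewrite -mulr_suml ler_wpM2r // sum_geometric_le.
  have [x hx xu] := nball_series hB hu hs; exists x => // n.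
  pose t K n := \sum_(0 <= k < K) u k n.
  have tE K : S_op d p (t K) n - z * t K n = y n - z^-1 ^+ K * iter K (S_op d p) y n.
    elim: K => [|K IH].
      rewrite expr0 mul1r subrr /t big_geq // mulr0 subr0.
      rewrite -[RHS](@S_op_const _ _ d0 d2 p 0 n).
      by apply: eq_S_op => m _; rewrite big_geq.
    have -> : t K.+1 = fun n => - z^-1 ^+ K.+1 * iter K (S_op d p) y n + t K n.
      by apply/funext => m; rewrite /t big_nat_recr //= addrC.
    rewrite S_op_lin /= mulrDr opprD addrACA IH exprS.
    by field.
  apply/subr0_eq/cmod_small => e e0; have e2 := divr_gt0 e0 (ltr0Sn R 1).
  have z1' : 0 < 1 + cmod z by rewrite addr_gt0.
  have [K1 h1] := xu _ (divr_gt0 e2 z1'); have [K2 h2] := geometric_small C r01 e2.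
  pose K := (K1 + K2)%N; pose v m := x m - t K m.
  have vs m : cmod (v m) <= e / 2 / (1 + cmod z) by apply: h1; exact: leq_addr.
  have -> : S_op d p x n - z * x n - y n =
      S_op d p v n + - z * v n - z^-1 ^+ K * iter K (S_op d p) y n.
    have -> : x = fun m => 1 * t K m + v m by apply/funext => m; rewrite /v; ring.
    rewrite S_op_lin; have := tE K.
    move: (S_op d p (t K) n) (z^-1 ^+ K * _) => a b E.
    have -> : a = z * t K n + (y n - b) by rewrite -E; ring.
    by ring.
  rewrite [leRHS]splitr (le_trans (ler_cmodD _ _)) // lerD //.
    rewrite (le_trans (ler_cmodD _ _)) // -[leRHS](divfK (lt0r_neq0 z1')).
    rewrite [leRHS]mulrDr [X in _ <= X + _]mulr1 lerD ?cmod_S_op_le // cmodM cmodN mulrC.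
    by rewrite ler_wpM2r ?cmod_ge0.
  rewrite cmodN cmodM cmodX cmodV (le_trans _ (h2 K (leq_addl _ _))) //.
  rewrite ler_wpM2l ?exprn_ge0 ?(ltW r0) //.
  exact: (nball_le hB (nball_iter_S_op K hy) n).
have bx k : B (r ^+ k * C) x.
  elim: k => [|k IH]; first by rewrite mul1r.
  have := nball_scale hB z^-1 (nball_S_op IH); rewrite cmodV exprS -mulrA.
  by congr (B _); apply/funext => m; rewrite xz mulrA mulVf // mul1r.
apply: cmod_small => e e0; have [k /(_ k (leqnn k))] := geometric_small C r01 e0.
by apply: le_trans; exact: (nball_le hB (bx k) n).
Qed.

End Contraction.

(** * Reduction to the shifted sequences *)

Section Shift.
Context {R : realType}.
Variables (d : nat -> nat) (p : nat -> R).
Hypotheses (d0 : d 0%N = 1%N) (d2 : forall j, (1 <= j)%N -> (2 <= d j)%N).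
Hypothesis p01 : forall j, (1 <= j)%N -> 0 < p j <= 1.
Implicit Types (w x : nat -> R[i]).

Definition slope (z : R[i]) : R[i] := (z - (1 - p 1%N)%:C) / (p 1%N)%:C.

Lemma slopeX z : slope z ^+ d 1%N = f d p 1 z.
Proof. by []. Qed.

Lemma p1_neq0 : (p 1%N)%:C != 0.
Proof. by rewrite -cmod_eq0 cmodR normr_eq0 gt_eqF //; case/andP: (p01 (leqnn 1)). Qed.

Lemma ftilde_shift j z :
  ftilde d p j.+1 z = ftilde (dshift d) (pshift p) j (f d p 1 z).
Proof. by elim: j => [//|j IH]; rewrite [LHS]/= -/(ftilde d p j.+1 z) IH. Qed.

Lemma S_op_resolvent z w m i : (i < d 1%N)%N ->
  S_op d p w (d 1%N * m + i) - z * w (d 1%N * m + i)%N = (p 1%N)%:C *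
    ((if (i.+1 < d 1%N)%N then w (d 1%N * m + i.+1)%N
      else S_op (dshift d) (pshift p) (fun n => w (d 1%N * n)%N) m)
     - slope z * w (d 1%N * m + i)%N).
Proof.
move=> id; rewrite S_op_shift // /slope; case: ifP => _;
  move: (w (_ + i)%N) ((1 - _)%:C) ((p _)%:C) p1_neq0 => a b c c0; field; exact: c0.
Qed.

Lemma eigen_digit z w : (forall n, S_op d p w n = z * w n) ->
  forall m i, (i < d 1%N)%N -> w (d 1%N * m + i)%N = slope z ^+ i * w (d 1%N * m)%N.
Proof.
move=> wz m; elim=> [|i IH] id; first by rewrite mul1r addn0.
have := S_op_resolvent z w m (ltnW id); rewrite wz subrr id => /esym/eqP.
rewrite mulf_eq0 (negbTE p1_neq0) subr_eq0 => /eqP ->.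
by rewrite IH ?(ltnW id) // mulrA -exprS.
Qed.

Lemma eigen_shift z w : (forall n, S_op d p w n = z * w n) ->
  forall m, S_op (dshift d) (pshift p) (fun n => w (d 1%N * n)%N) m =
            f d p 1 z * w (d 1%N * m)%N.
Proof.
move=> wz m; have d1 : (0 < d 1%N)%N by rewrite (leq_trans _ (d2 _)).
have dl : ((d 1%N).-1 < d 1%N)%N by rewrite prednK.
have := S_op_resolvent z w m dl; rewrite wz subrr prednK // ltnn => /esym/eqP.
rewrite mulf_eq0 (negbTE p1_neq0) subr_eq0 => /eqP ->.
by rewrite (eigen_digit wz) // mulrA -exprS prednK.
Qed.

(** The solution of [x_(i+1) - a x_i = y_i] with [x_0 = x]. *)
Fixpoint residue (a : R[i]) (y : nat -> nat -> R[i]) (x : nat -> R[i])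
    (i n : nat) : R[i] :=
  if i is j.+1 then a * residue a y x j n + y j n else x n.

Lemma residueE a y x i n :
  residue a y x i n = a ^+ i * x n + residue a y (fun=> 0) i n.
Proof.
elim: i => [|i IH] /=; first by rewrite mul1r addr0.
by rewrite IH exprS; ring.
Qed.

Variable B : R -> (nat -> R[i]) -> Prop.
Hypothesis hB : ball_space B.

(** The constant depends on [a] and [N] only, so that radii stay linear in [C] through the
    reduction. *)
Lemma nball_residue a N : exists2 K, 0 <= K & forall y x C C',
  (forall i, B C (y i)) -> B C' x -> forall i, (i <= N)%N ->
  B (K * (C + C')) (residue a y x i).
Proof.
elim: N => [|N [K K0 hK]].
  exists 1 => // y x C C' hy hx [] // _.
  by apply: (nball_mono hB _ hx); rewrite mul1r lerDr (nball_ge0 hB (hy 0%N)).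
exists (K + (cmod a * K + 1)) => [|y x C C' hy hx i].
  by rewrite !addr_ge0 ?mulr_ge0 ?cmod_ge0.
have C0 := nball_ge0 hB (hy 0%N); have C'0 := nball_ge0 hB hx.
have CC := addr_ge0 C0 C'0; have aK := mulr_ge0 (cmod_ge0 a) K0.
rewrite leq_eqVlt => /orP[/eqP ->|]; last first.
  rewrite ltnS => iN; apply: (nball_mono hB _ (hK _ _ _ _ hy hx _ iN)).
  by rewrite ler_wpM2r // lerDl addr_ge0.
have := nball_lin hB a (hK _ _ _ _ hy hx _ (leqnn N)) (hy N).
apply: (nball_mono hB); have Ks := mulr_ge0 K0 CC.
have -> : (K + (cmod a * K + 1)) * (C + C') =
  K * (C + C') + (cmod a * (K * (C + C')) + (C + C')) by ring.
by rewrite -[leLHS]add0r lerD // lerD // lerDl.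
Qed.

Lemma invertible_at_shift z :
  invertible_at (dshift d) (pshift p) B (f d p 1 z) -> invertible_at d p B z.
Proof.
move=> [M M0 [solve inj]].
set D := d 1%N; have D0 : (0 < D)%N by rewrite (leq_trans _ (d2 _)).
set a := slope z; have P := p1_neq0.
have [K K0 hK] := nball_residue a D.
pose c := cmod (p 1%N)%:C^-1; have c0 : 0 <= c by exact: cmod_ge0.
exists (D%:R * (K * (c + M * (K * c)))) => [|].
  by rewrite !(mulr_ge0, addr_ge0).
split=> [C y hy|C x hx xz n].
  pose y' i n := (p 1%N)%:C^-1 * y (D * n + i)%N.
  have hy' i : B (c * C) (y' i).
    apply: (nball_scale hB); apply: (nball_comp hB (g := fun n => (D * n + i)%N) _ hy).
    by move=> m n /addIn/eqP; rewrite eqn_pmul2l // => /eqP.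
  (* With zero initial value, [residue] at [D] is the sum of the [a ^ (D - 1 - j) y'_j], the right
     side of the reduced equation. *)
  have := hK _ _ _ _ hy' (nball0 hB (lexx 0)) _ (leqnn D).
  rewrite addr0 => /solve[x0 hx0 x0E].
  pose x n := residue a y' x0 (n %% D) (n %/ D)%N.
  have xE m i : (i < D)%N -> x (D * m + i)%N = residue a y' x0 i m.
    by move=> iD; rewrite /x mulnC modnMDl divnMDl // modn_small // divn_small // addn0.
  exists x => [|n].
    rewrite -mulrA; apply: (nball_glue hB) => // i iD.
    have := hK _ _ _ _ hy' hx0 _ (ltnW iD).
    have -> : K * (c * C + M * (K * (c * C))) = K * (c + M * (K * c)) * C by ring.
    by congr (B _); apply/funext => m; rewrite xE.
  rewrite (divn_eq n D) mulnC; have nD : (n %% D < D)%N by rewrite ltn_mod.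
  move: (n %/ D)%N (n %% D)%N nD => m i iD; rewrite (S_op_resolvent z x m iD) -/D -/a.
  have -> : y (D * m + i)%N = (p 1%N)%:C * y' i m by rewrite /y' mulVKf.
  congr (_ * _); rewrite [x (D * m + i)%N]xE //; case: ifP => iD1.
    by rewrite xE //= [_ + y' i m]addrC addrK.
  have -> : (fun n => x (D * n)%N) = x0.
    by apply/funext => k; rewrite -[(D * k)%N]addn0 xE.
  have Di : D = i.+1 by move: iD iD1; lia.
  have /eqP := x0E m; rewrite subr_eq => /eqP ->.
  by rewrite -slopeX -/D -/a [residue a y' x0 i m]residueE Di /= exprS; ring.
(* The residue 0 part solves the shifted eigenvalue equation at [f d p 1 z], so it vanishes; it
   determines the other residues. *)
have w0 m : x (D * m)%N = 0.
  apply: (inj C (fun n => x (D * n)%N)); last exact: eigen_shift.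
  apply: (nball_comp hB (g := fun n => (D * n)%N) _ hx).
  by move=> k l /eqP; rewrite eqn_pmul2l // => /eqP.
by rewrite (divn_eq n D) mulnC (eigen_digit xz) ?ltn_mod // w0 mulr0.
Qed.

End Shift.

Lemma invertible_at_ftilde (R : realType) (B : R -> (nat -> R[i]) -> Prop) :
  ball_space B -> forall j d (p : nat -> R) z, d 0%N = 1%N ->
  (forall j, (1 <= j)%N -> (2 <= d j)%N) ->
  (forall j, (1 <= j)%N -> 0 < p j <= 1) ->
  1 < cmod (ftilde d p j z) -> invertible_at d p B z.
Proof.
move=> hB; elim=> [|j IH] d p z d0 d2 p01; first exact: invertible_at_gt1.
rewrite ftilde_shift => h; apply: invertible_at_shift => //.
apply: IH => // [i|i _]; [exact: dshift_ge2 | exact: p01].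
Qed.

(** * Truncated eigenvectors *)

Section Escape.
Context {R : realType}.
Variables (d : nat -> nat) (p : nat -> R).
Hypothesis d2 : forall j, (1 <= j)%N -> (2 <= d j)%N.
Hypothesis p01 : forall j, (1 <= j)%N -> 0 < p j <= 1.

(** Outside the open unit disk the affine map does not decrease the modulus, since
    [(1 - p j) * (cmod z - 1) >= 0]; the power [d j >= 2] at least squares it. *)
Lemma cmod_f_ge j z : (1 <= j)%N -> 1 <= cmod z -> cmod z ^+ 2 <= cmod (f d p j z).
Proof.
move=> j1 z1; have /andP[p0 p1] := p01 j1.
have h : cmod z <= cmod ((z - (1 - p j)%:C) / (p j)%:C).
  rewrite cmodM cmodV (ger0_cmodR (ltW p0)) ler_pdivlMr //.
  have := ler_cmodD (z - (1 - p j)%:C) (1 - p j)%:C.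
  rewrite subrK ger0_cmodR ?subr_ge0 // => h.
  have : 0 <= (1 - p j) * (cmod z - 1) by rewrite mulr_ge0 ?subr_ge0.
  by lra.
rewrite /f cmodX (le_trans (_ : _ <= cmod z ^+ d j)) //.
  by rewrite ler_weXn2l // d2.
by rewrite lerXn2r ?nnegrE ?cmod_ge0.
Qed.

Lemma ftilde_growth j z k : 1 <= cmod (ftilde d p j z) ->
  cmod (ftilde d p j z) ^+ k.+1 <= cmod (ftilde d p (j + k) z).
Proof.
set t := cmod _ => t1; elim: k => [|k IH]; first by rewrite addn0.
have tk : 1 <= cmod (ftilde d p (j + k) z) by rewrite (le_trans _ IH) // exprn_ege1.
rewrite addnS exprS (le_trans _ (cmod_f_ge (ltn0Sn _) tk)) // expr2.
rewrite ler_pM ?exprn_ge0 ?cmod_ge0 ?(le_trans ler01) //.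
by rewrite (le_trans _ IH) // exprS ler_peMr ?exprn_ege1 // (le_trans ler01).
Qed.

(** An iterate of modulus [t > 1] is followed by iterates of modulus at least [t ^+ k.+1], so the
    upper limit is infinite. *)
Lemma EP z : E d p z <-> forall j, cmod (ftilde d p j z) <= 1.
Proof.
rewrite /E /= /limn_esup limf_esupE; split=> [|h]; last first.
  apply: le_lt_trans (ltry 1); apply: ereal_inf_le.
  exists (ereal_sup ((fun j => (cmod (ftilde d p j z))%:E) @` setT)%classic).
    by exists setT => //; exact: filterT.
  by apply: ge_ereal_sup => _ [j _ <-]; rewrite lee_fin.
move=> /ereal_inf_lt[_ [V [N _ NV] <-] supV] j; rewrite leNgt; apply/negP.
set t := cmod _ => t1; have t0 : 0 < t by apply: lt_trans t1.
have [M hM] : exists M : R, forall k, (N <= k)%N -> cmod (ftilde d p k z) <= M.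
  move: supV; set S := ereal_sup _ => S_lty.
  have hS k : (N <= k)%N -> ((cmod (ftilde d p k z))%:E <= S)%E.
    by move=> Nk; apply: ereal_sup_ubound; exists k => //; exact: NV.
  exists (fine S) => k /hS kS; rewrite -lee_fin fineK // fin_numElt S_lty andbT.
  by apply: lt_le_trans kS; exact: ltNyr.
have ti : 0 <= t^-1 < 1 by rewrite invr_ge0 ltW //= invf_lt1.
have [K hK] := geometric_small (`|M| + 1) ti ltr01.
have Nk : (N <= j + (N + K))%N by rewrite addnCA leq_addr.
have := le_trans (ftilde_growth (N + K) (ltW t1)) (hM _ Nk); rewrite -/t.
have := hK (N + K).+1 (leqW (leq_addl _ _)).
rewrite exprVn mulrC ler_pdivrMr ?exprn_gt0 // mul1r => h1 h2.
by have := ler_norm M; lra.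
Qed.

End Escape.

Section Eigenvector.
Context {R : realType}.
Variables (d : nat -> nat) (p : nat -> R).
Hypothesis p01 : forall j, (1 <= j)%N -> 0 < p j <= 1.
Implicit Types (w x : nat -> R[i]).

(** Row [n] ends at column [n.+1] with a nonzero entry, so the eigenvalue equation is a recurrence
    for [v n.+1]. *)
Lemma eigenvector_exists z :
  exists2 v, v 0%N = 1 & forall n, S_op d p v n = z * v n.
Proof.
pose next w n := (z * w n - \sum_(0 <= m < n.+1) (s d p n m)%:C * w m)
                 / (s d p n n.+1)%:C.
(* [eg k] is correct at indices up to [k]; this encodes a recursion on all earlier values. *)
pose fix eg k n {struct k} : R[i] := if k is k'.+1 then
  (if (n <= k')%N then eg k' n else next (eg k') k') else 1.
pose v n := eg n n.
have egE k n : (n <= k)%N -> eg k n = v n.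
  elim: k => [|k IH] /=; first by case: n.
  rewrite leq_eqVlt => /orP[/eqP -> //|]; rewrite ltnS => nk.
  by rewrite nk IH.
exists v => // n; rewrite S_opE big_nat_recr //=.
have sn : (s d p n n.+1)%:C != 0.
  by rewrite s_succ -cmod_eq0 cmodR normr_eq0 gt_eqF // reach_gt0.
have -> : v n.+1 = next (eg n) n by rewrite /v /= ltnn.
rewrite /next mulrC divfK // egE //.
rewrite [X in X + _](_ : _ = \sum_(0 <= m < n.+1) (s d p n m)%:C * eg n m).
  by rewrite addrC subrK.
by apply: eq_big_nat => m /andP[_]; rewrite ltnS => /egE ->.
Qed.

End Eigenvector.

(** Induction through the shift, which keeps both the eigenvalue equation and the value 1 at 0. At
    stage 0, [w 1] is the slope of [z], whose power of exponent [d 1] is [ftilde d p 1 z]. *)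
Lemma cmod_eigen_q (R : realType) k d (p : nat -> R) z w : d 0%N = 1%N ->
  (forall j, (1 <= j)%N -> (2 <= d j)%N) ->
  (forall j, (1 <= j)%N -> 0 < p j <= 1) ->
  (forall j, cmod (ftilde d p j z) <= 1) ->
  (forall n, S_op d p w n = z * w n) -> w 0%N = 1 -> cmod (w (q d k)) <= 1.
Proof.
elim: k d p z w => [|k IH] d p z w d0 d2 p01 zE wz w0.
  have := eigen_digit d0 d2 p01 wz 0 (d2 1%N isT).
  rewrite muln0 q0 // => ->; rewrite w0 mulr1 expr1.
  have := zE 1%N; rewrite /= -slopeX cmodX => h; rewrite leNgt; apply/negP => s1.
  by move: h; rewrite leNgt exprn_egt1 //; have := d2 1%N isT; case: (d 1%N).
rewrite q_dshift //.
apply: (IH (dshift d) (pshift p) (f d p 1 z) (fun n => w (d 1%N * n)%N)) => //.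
- exact: dshift_ge2.
- by move=> j _; exact: p01.
- by move=> j; rewrite -ftilde_shift.
- exact: eigen_shift.
- by rewrite muln0.
Qed.

Section Truncation.
Context {R : realType}.
Variables (d : nat -> nat) (p : nat -> R).
Hypotheses (d0 : d 0%N = 1%N) (d2 : forall j, (1 <= j)%N -> (2 <= d j)%N).
Hypothesis p01 : forall j, (1 <= j)%N -> 0 < p j <= 1.
Variables (z : R[i]) (v : nat -> R[i]).
Hypotheses (zE : forall j, cmod (ftilde d p j z) <= 1).
Hypotheses (v0 : v 0%N = 1) (vz : forall n, S_op d p v n = z * v n).

Definition trunc k n : R[i] := if (n < q d k)%N then v n else 0.

Definition defect k n : R[i] := S_op d p (trunc k) n - z * trunc k n.

Lemma defectE k : exists2 c, cmod c <= 1 & forall n K, (zeta d n <= K)%N ->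
  defect k n = c * (n.+1 == q d k)%:R +
    \sum_(0 <= r < K) (halt p r)%:C * ((k < r)%N && (n.+1 == q d r))%:R.
Proof.
(* Among the rows below [q d k], only the last one reaches outside the truncation; its lost term is
   [reach] times [v (q d k)]. *)
pose c := - ((reach p (zeta d (q d k).-1))%:C * v (q d k)); exists c.
  have rp := ltW (reach_gt0 p01 _); rewrite cmodN cmodM ger0_cmodR //.
  by rewrite mulr_ile1 ?cmod_ge0 ?reach_le1 // (cmod_eigen_q k d0 d2 p01 zE vz).
move=> n K zK; rewrite /defect; have [nk|kn] := ltnP n (q d k).
  have s0 : \sum_(0 <= r < K) (halt p r)%:C *
      ((k < r)%N && (n.+1 == q d r))%:R = 0 :> R[i].
    rewrite big1 // => r _; case: ltnP => [kr|_] /=; last by rewrite mulr0.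
    by rewrite ltn_eqF ?mulr0 // (leq_ltn_trans nk) // ltn_q.
  rewrite s0 addr0 /trunc nk -vz; case: eqVneq => [nq|nq].
    rewrite mulr1 !S_opE [in LHS]big_nat_recr //= [X in _ - X]big_nat_recr //=.
    have qk : (n.+1 < q d k)%N = false by rewrite nq ltnn.
    rewrite qk mulr0 addr0 [X in X - _](_ : _ =
        \sum_(0 <= m < n.+1) (s d p n m)%:C * v m); last first.
      by apply: eq_big_nat => m /andP[_ mn]; rewrite -nq mn.
    by rewrite opprD addNKr s_succ /c -nq.
  rewrite mulr0; apply/eqP; rewrite subr_eq0; apply/eqP.
  apply: eq_S_op => m mn; rewrite (leq_ltn_trans mn) // ltn_neqAle nq.
  exact: nk.
have qn : (n.+1 == q d k) = false by rewrite gtn_eqF.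
have tn m : (n <= m)%N -> trunc k m = 0.
  by move=> nm; rewrite /trunc ltnNge (leq_trans kn nm).
rewrite qn mulr0 add0r tn // mulr0 subr0 (S_op_carry d0 d2 p _ zK) tn //.
rewrite mulr0 addr0.
apply: eq_bigr => r _; congr (_ * _); rewrite /trunc /carry.
case: (boolP (q d r %| n.+1)%N) => qr; last first.
  rewrite [(n.+1 < _)%N]ltnNge (leqW kn) /=; case: eqVneq => [e|_]; last by rewrite andbF.
  by rewrite e dvdnn in qr.
(* For [r > k] the target is a multiple of [q d k], hence lies below [q d k] only if it is 0, where
   [v] is 1. For [r <= k], divisibility by [q d r] keeps the target at [q d k] or above, except when
   [n.+1 = q d k], already excluded. *)
have [kr|rk] := ltnP k r => /=.
  have [->|nr] := eqVneq n.+1 (q d r); first by rewrite subnn q_gt0.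
  case: ifP => // lt.
  have : (q d k %| n.+1 - q d r)%N.
    by apply: dvdn_sub; [apply: dvdn_trans qr|]; apply: dvdn_q; exact: ltnW.
  have pos : (0 < n.+1 - q d r)%N.
    by rewrite subn_gt0 ltn_neqAle eq_sym nr dvdn_leq.
  by move=> /(dvdn_leq pos); rewrite leqNgt lt.
case: ifP => // lt.
have : (q d r %| n.+1 - q d k)%N by apply: dvdn_sub => //; exact: dvdn_q.
move=> /dvdn_leq; rewrite subn_gt0 ltnS kn => /(_ isT).
by move: lt kn; lia.
Qed.

(** The radius 2 is 1 for the boundary term and 1 for the total of the weights [halt p r]. *)
Lemma nball_defect (B : R -> (nat -> R[i]) -> Prop) k :
  ball_space B -> B 2 (defect k).
Proof.
move=> hB; have [c c1 cE] := defectE k.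
pose u r n : R[i] := (halt p r)%:C * ((k < r)%N && (n.+1 == q d r))%:R.
have dq r n : (n.+1 == q d r) = (n == (q d r).-1).
  by have := q_gt0 d0 d2 r; case: (q d r).
have hu r : B (halt p r) (u r).
  have -> : halt p r = cmod (halt p r)%:C * 1.
    by rewrite mulr1 ger0_cmodR // halt_ge0.
  apply: (nball_scale hB); case: (k < r)%N => /=; last exact: (nball0 hB).
  under eq_fun do rewrite dq; exact: nball_delta.
have hs K : \sum_(0 <= r < K) halt p r <= 1.
  by rewrite sum_halt // reach0 gerBl ltW // reach_gt0.
have [w hw wu] := nball_series hB hu hs.
have := nball_add hB (nball_scale hB c (nball_delta hB (q d k).-1)) hw.
rewrite mulr1 => h; apply: (@nball_mono _ _ hB (cmod c + 1)).
  by rewrite -[leRHS]/(1 + 1) lerD2r.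
move: h; congr (B _); apply/funext => n; rewrite -dq.
apply/subr0_eq/cmod_small => e e0; have [K0 hK] := wu e e0.
rewrite (cE n (zeta d n + K0)%N (leq_addr _ _)) [c * _ + w n]addrC addrKA.
by apply: hK; exact: leq_addl.
Qed.

(** At a fixed [n] only the index [j] with [n.+1 = q d j] contributes, if there is one. The bound is
    meant to be summed over [k]. *)
Lemma cmod_defect_le n : exists j, forall k,
  cmod (defect k n) <= (k == j)%:R + halt p j * (k < j)%:R.
Proof.
have [[j nj]|h] := pselect (exists j, n.+1 = q d j).
  exists j => k; have [c c1 /(_ n (zeta d n + j.+1)%N (leq_addr _ _)) ->] := defectE k.
  rewrite (le_trans (ler_cmodD _ _)) // nj.
  have E i : (q d j == q d i) = (i == j).
    by apply/eqP/eqP => [/(q_inj d0 d2)|->].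
  rewrite lerD //.
    by rewrite E cmodM; case: eqP; rewrite ?cmod0 ?mulr0 // cmod1 mulr1.
  have jK : (j < zeta d n + j.+1)%N by rewrite addnS ltnS leq_addl.
  rewrite big_mkord (bigD1 (Ordinal jK)) //= eqxx andbT big1 => [|i].
    rewrite addr0 cmodM ger0_cmodR ?halt_ge0 //.
    by case: ltnP; rewrite ?cmod0 ?cmod1.
  by rewrite -val_eqE /= E => /negbTE ->; rewrite andbF mulr0.
exists 0%N => k; have [c c1 /(_ n (zeta d n) (leqnn _)) ->] := defectE k.
have E i : (n.+1 == q d i) = false by apply/eqP => e; apply: h; exists i.
rewrite E mulr0 add0r big1 => [|i _]; last by rewrite E andbF mulr0.
by rewrite cmod0 mulr0 addr0.
Qed.

End Truncation.

(** * From bounded inverses to balls *)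

Section Spectrum.
Context {R : realType}.
Variables (d : nat -> nat) (p : nat -> R).
Variables (V : set (nat -> R[i])) (N : (nat -> R[i]) -> \bar R).
Variable B : R -> (nat -> R[i]) -> Prop.

Definition norm_balls : Prop :=
  (forall C w, B C w <-> V w /\ (N w <= C%:E)%E) /\
  (forall w, V w -> (N w < +oo)%E).

Hypothesis VNB : norm_balls.
Hypothesis B_ge0 : forall C w, B C w -> 0 <= C.

Lemma norm_fineK w : V w -> (fine (N w))%:E = N w.
Proof.
have [BE fin] := VNB => Vw; apply: fineK.
(* A norm equal to [-oo] would put [w] in the ball of radius -1. *)
rewrite fin_numElt fin // andbT ltNge; apply/negP => Nw.
have /B_ge0 : B (-1) w by apply/BE; split=> //; rewrite (le_trans Nw) // leNye.
by rewrite oppr_ge0 ler10.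
Qed.

Lemma norm_ball_fine w : V w -> B (fine (N w)) w.
Proof. by move=> Vw; have [BE _] := VNB; apply/BE; rewrite norm_fineK. Qed.

(** The left inverse identity bounds [x] by its image. The radius [C'] only records that [x] lies in
    the space. *)
Lemma bounded_below_of_not_spectrum z : ~ spectrum V N (S_op d p) z ->
  exists2 M, 0 <= M & forall C' C x, B C' x ->
    B C (fun n => S_op d p x n - z * x n) -> B (M * C) x.
Proof.
have [BE _] := VNB; move=> /contrapT[T [[TV _ [M TM]] Tinv]].
exists `|M| => // C' C x /BE[Vx _] hy; have C0 := B_ge0 hy.
have /BE[Vy yC] := hy; apply/BE; split=> //.
have [Txx _] := Tinv x Vx; rewrite -{1}Txx (le_trans (TM _ Vy)) //.
rewrite -(norm_fineK Vy) -EFinM lee_fin.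
have y0 := B_ge0 (norm_ball_fine Vy).
rewrite (le_trans (ler_wpM2r y0 (ler_norm M))) // ler_wpM2l //.
by rewrite -lee_fin norm_fineK.
Qed.

Hypothesis B_lin : forall a C C' w w', B C w -> B C' w' ->
  exists D, B D (fun n => a * w n + w' n).
Hypothesis B_S_op : forall C w, B C w -> B C (S_op d p w).

(** Solutions are chosen to form [T]; linearity and the left inverse identity come from uniqueness.
    The assumptions on [B] are weaker than [ball_space], so that [c] is covered. *)
Lemma not_spectrum_of_invertible z : invertible_at d p B z ->
  ~ spectrum V N (S_op d p) z.
Proof.
move=> [M M0 [solve inj]]; apply; have [BE fin] := VNB.
have VB C w : B C w -> V w by move=> /BE[].
have VL a w w' : V w -> V w' -> V (fun n => a * w n + w' n).
  move=> /norm_ball_fine hw /norm_ball_fine hw'.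
  by have [D /VB] := B_lin a hw hw'.
have VS w : V w -> V (S_op d p w) by move=> /norm_ball_fine/B_S_op/VB.
have uniq x x' : V x -> V x' ->
    (forall n, S_op d p x n - z * x n = S_op d p x' n - z * x' n) -> x = x'.
  move=> Vx Vx' e; have hd := norm_ball_fine (VL (-1) _ _ Vx' Vx).
  apply/funext => n; apply/subr0_eq; rewrite -(inj _ _ hd _ n) => [|m].
    by ring.
  rewrite S_op_lin; have := e m; move: (S_op _ _ x m) => a h.
  have -> : a = S_op d p x' m - z * x' m + z * x m by rewrite -h; ring.
  by ring.
have ex y : exists x, V y -> B (M * fine (N y)) x /\
    forall n, S_op d p x n - z * x n = y n.
  have [Vy|] := pselect (V y); last by exists y.
  by have [x hx xE] := solve _ _ (norm_ball_fine Vy); exists x.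
have [T hT] := choice ex.
have TV w : V w -> V (T w) by move=> /hT[/VB].
have TE w : V w -> forall n, S_op d p (T w) n - z * T w n = w n by move=> /hT[].
exists T; split; first split=> //.
- move=> a w w' Vw Vw'; apply: uniq => [||n].
  + exact/TV/VL.
  + by apply: VL; exact: TV.
  + rewrite TE; last exact: VL.
    by rewrite S_op_lin -(TE w) // -(TE w') //; ring.
- exists M => w Vw; have [/BE[_]] := hT w Vw.
  by rewrite EFinM norm_fineK.
move=> w Vw; split; last by apply/funext => n; exact: TE.
have Vw' : V (fun n => S_op d p w n - z * w n).
  have := VL (- z) _ _ Vw (VS _ Vw); congr V; apply/funext => n.
  by rewrite mulNr addrC.
apply: uniq => [||n] //; first exact: TV.
exact: TE.
Qed.

End Spectrum.

(** * The balls of the norms of c_0, c and l^alpha *)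

Section NormBalls.
Context {R : realType}.
Implicit Type w : nat -> R[i].

Definition c_ball (C : R) w : Prop := c_seq w /\ forall n, cmod (w n) <= C.

Lemma sup_norm_le w (C : R) :
  (sup_norm w <= C%:E)%E <-> forall n, cmod (w n) <= C.
Proof.
split=> [h n|h].
  by rewrite -lee_fin (le_trans _ h) //; apply: ereal_sup_ubound; exists n.
by apply: ge_ereal_sup => _ [n _ <-]; rewrite lee_fin.
Qed.

Lemma c_seqP w : c_seq w <-> exists l : R[i], forall e : R, 0 < e ->
  exists N, forall n, (N <= n)%N -> cmod (w n - l) <= e.
Proof.
split=> [/= wl|[l /cvgc_cmodP wl]].
  by exists (lim ((w : nat -> R[i]^o) @ \oo)%classic); apply/cvgc_cmodP.
by rewrite /c_seq /=; apply/cvg_ex; exists l.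
Qed.

Lemma c0_seq_c w : c0_seq w -> c_seq w.
Proof.
move=> /c0_seqP h; apply/c_seqP; exists 0 => e /h[N hN]; exists N => n /hN.
by rewrite subr0.
Qed.

Lemma c_seq_bounded w : c_seq w -> exists C, forall n, cmod (w n) <= C.
Proof.
move=> /c_seqP[l /(_ 1 ltr01)[N hN]].
exists (cmod l + 1 + \sum_(0 <= k < N) cmod (w k)) => n.
have s0 : 0 <= \sum_(0 <= k < N) cmod (w k)
  by rewrite sumr_ge0 // => k _; exact: cmod_ge0.
have l0 := cmod_ge0 l.
have [nN|/hN h] := ltnP n N; last first.
  rewrite -(subrK l (w n)) (le_trans (ler_cmodD _ _)) //.
  by rewrite addrC -addrA lerD2l ler_wpDr.
rewrite big_mkord (bigD1 (Ordinal nN)) //= addrCA lerDl.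
by rewrite !addr_ge0 // sumr_ge0 // => k _; exact: cmod_ge0.
Qed.

Lemma c0_norm_balls : norm_balls c0_seq sup_norm (@c0_ball R).
Proof.
split=> [C w|w /c0_seq_c/c_seq_bounded[C /sup_norm_le h]].
  by rewrite /c0_ball sup_norm_le.
exact: le_lt_trans h (ltry _).
Qed.

Lemma c_norm_balls : norm_balls c_seq sup_norm c_ball.
Proof.
split=> [C w|w /c_seq_bounded[C /sup_norm_le h]].
  by rewrite /c_ball sup_norm_le.
exact: le_lt_trans h (ltry _).
Qed.

Lemma l_norm_balls alpha : 1 <= alpha ->
  norm_balls (l_seq alpha) (l_norm alpha) (@l_ball R alpha).
Proof.
move=> a1; have a0 : 0 < alpha by exact: lt_le_trans ltr01 a1.
have ai : 0 < alpha^-1 by rewrite invr_gt0.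
split=> // C w; rewrite /l_seq /= l_normE //.
set S := (\sum_(k <oo) _)%E.
have part m : ((\sum_(0 <= n < m) cmod (w n) `^ alpha)%:E <= S)%E.
  rewrite -sumEFin; apply: nneseries_lim_ge => k _ _.
  by rewrite lee_fin powR_ge0.
have S0 : (0 <= S)%E by have := part 0%N; rewrite big_geq.
split=> [[C0 h]|[_ h]].
  suff hS : (S `^ alpha^-1 <= C%:E)%E by split=> //; exact: le_lt_trans hS (ltry _).
  have SC : (S <= (C `^ alpha)%:E)%E.
    apply: lime_le.
      by apply: is_cvg_nneseries => k _ _; rewrite lee_fin powR_ge0.
    by apply: nearW => m; rewrite sumEFin lee_fin.
  have -> : C%:E = ((C `^ alpha)%:E `^ alpha^-1)%E.
    by rewrite poweR_EFin -powRrM divff ?gt_eqF // powRr1.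
  by apply: gt0_ler_poweR; rewrite ?(ltW ai) // in_itv /= ?S0 ?lee_fin ?powR_ge0 leey.
have C0 : 0 <= C by rewrite -lee_fin (le_trans _ h) // poweR_ge0.
split=> // m; rewrite (ler_powRV a1) ?sumr_ge0 // => [|k _]; last exact: powR_ge0.
rewrite -lee_fin (le_trans _ h) // -poweR_EFin.
apply: gt0_ler_poweR; rewrite ?(ltW ai) // ?in_itv /= ?S0 ?leey ?andbT //.
by rewrite lee_fin sumr_ge0 // => k _; exact: powR_ge0.
Qed.

End NormBalls.

(** * The three spaces *)

Section Invertibility.
Context {R : realType}.
Variables (d : nat -> nat) (p : nat -> R).
Hypotheses (d0 : d 0%N = 1%N) (d2 : forall j, (1 <= j)%N -> (2 <= d j)%N).
Hypothesis p01 : forall j, (1 <= j)%N -> 0 < p j <= 1.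

Lemma l_ball_not_bounded_below alpha z : 1 <= alpha -> E d p z ->
  ~ exists2 M, 0 <= M & forall C' C x, l_ball alpha C' x ->
    l_ball alpha C (fun n => S_op d p x n - z * x n) -> l_ball alpha (M * C) x.
Proof.
move=> a1 /(EP d2 p01) zE [M M0 hM]; have hB := l_ball_space a1.
have [v v0 vz] := eigenvector_exists d p01 z.
have tv k : l_ball alpha (M * 2) (trunc d v k).
  apply: (hM _ _ _ (nball_finite hB (N := q d k) _)) => [n qn|].
    by rewrite /trunc ltnNge qn.
  exact: nball_defect.
(* Since [m < q d m], each partial sum of [v] is one of a truncation. *)
have vl : l_ball alpha (M * 2) v.
  split=> [|m]; first by rewrite mulr_ge0.
  have [_ /(_ m)] := tv m; apply: le_trans; rewrite le_eqVlt; apply/orP; left.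
  apply/eqP; apply: eq_big_nat => n /andP[_ nm].
  by rewrite /trunc (ltn_trans nm) // q_gt.
(* The image of [v] is 0, so the lower bound gives [v] radius 0, against [v 0 = 1]. *)
have : l_ball alpha (M * 0) v.
  apply: (hM _ _ _ vl); have := nball0 hB (lexx 0); congr (l_ball alpha _ _).
  by apply/funext => n; rewrite vz subrr.
by move=> /(nball_le hB)/(_ 0%N); rewrite v0 cmod1 mulr0 ler10.
Qed.

Lemma S_op_sum (w : nat -> nat -> R[i]) K n :
  S_op d p (fun m => \sum_(0 <= k < K) w k m) n = \sum_(0 <= k < K) S_op d p (w k) n.
Proof.
rewrite S_opE; under eq_bigr do rewrite mulr_sumr.
by rewrite exchange_big_nat; apply: eq_bigr => k _; rewrite S_opE.
Qed.

Lemma halt_small (e : R) : 0 < e -> exists J, forall j, (J <= j)%N -> halt p j <= e.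
Proof.
move=> e0; have [K||l [lr _ le]] := @nondecreasing_sup R (fun K => - reach p K) 0.
- by rewrite lerN2 -subr_ge0 -haltE halt_ge0.
- by move=> K; rewrite oppr_le0 ltW // reach_gt0.
have [J hJ] := le e e0; exists J => j /hJ; have := lr j.+1.
by rewrite haltE; lra.
Qed.

(** The refuted estimate concerns sequences of c_0 and concludes a mere sup bound, so a bounded
    inverse on c_0 or on c would provide it. *)
Lemma c0_ball_not_bounded_below z : E d p z ->
  ~ exists2 M, 0 <= M & forall C' C x, c0_ball C' x ->
    c0_ball C (fun n => S_op d p x n - z * x n) -> forall n, cmod (x n) <= M * C.
Proof.
move=> /(EP d2 p01) zE [M M0 hM]; have hB := @c0_ball_space R.
have [v v0 vz] := eigenvector_exists d p01 z.
pose W K n := \sum_(0 <= k < K) trunc d v k n.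
have M1 : 0 < M + 1 by rewrite ltr_wpDl.
(* This choice gives [M * e <= 1/2]. *)
pose e := (2 * (M + 1))^-1.
have e0 : 0 < e by rewrite invr_gt0 mulr_gt0.
have [J hJ] := halt_small e0.
(* At [n], the boundary term counts once. The weights [halt p j] contribute at most [J] if [j < J],
   and at most [e] for each [k] otherwise. *)
have hd K n : cmod (\sum_(0 <= k < K) defect d p z v k n) <= 1 + J%:R + K%:R * e.
  have [j dj] := cmod_defect_le d0 d2 p01 zE v0 vz n.
  rewrite (le_trans (cmod_sum _ _ _)) //.
  apply: (@le_trans _ _ (\sum_(0 <= k < K) ((k == j)%:R + (k < J)%:R + e))).
    apply: ler_sum => k _; rewrite (le_trans (dj k)) // -addrA lerD2l.
    have [jJ|/hJ Jj] := ltnP j J.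
      rewrite ler_wpDr ?(ltW e0) //.
      have [kj|_] := ltnP k j; last by rewrite mulr0.
      by rewrite (ltn_trans kj jJ) mulr1 haltE -[leRHS]/1; have := reach_gt0 p01 j.+1;
         have := reach_le1 p01 j; lra.
    rewrite ler_wpDl //; case: (k < j)%N; rewrite ?mulr1 // mulr0.
    exact: ltW.
  rewrite !big_split /= sumr_const_nat subn0 mulr_natl lerD2r lerD //.
    have [jK|Kj] := ltnP j K; last first.
      by rewrite big_nat big1 // => k /andP[_ kK]; rewrite ltn_eqF // (leq_trans kK).
    rewrite big_mkord (bigD1 (Ordinal jK)) //= eqxx big1 ?addr0 // => k.
    by rewrite -val_eqE /= => /negbTE ->.
  suff -> : \sum_(0 <= k < K) (k < J)%:R = (minn K J)%:R :> R.
    by rewrite ler_nat geq_minr.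
  elim: K => [|K IH]; first by rewrite big_geq // min0n.
  rewrite big_nat_recr //= IH -natrD; congr _%:R.
  have [KJ|JK] := ltnP K J.
    by rewrite (minn_idPl KJ) addn1.
  by rewrite (minn_idPr (leqW JK)) addn0.
have WK K : K%:R <= M * (1 + J%:R + K%:R * e).
  have hW : c0_ball (\sum_(0 <= k < q d K) cmod (W K k)) (W K).
    apply: (nball_finite hB) => n qn; rewrite /W big_nat big1 // => k /andP[_ kK].
    rewrite /trunc ltnNge (leq_trans _ qn) // dvdn_leq ?q_gt0 //.
    by apply: dvdn_q; exact: ltnW.
  have W0 : W K 0%N = K%:R%:C.
    rewrite /W; under eq_bigr do rewrite /trunc q_gt0 // v0.
    by rewrite sumr_const_nat subn0 rmorph_nat.
  have E0 : cmod (W K 0%N) = K%:R by rewrite W0 ger0_cmodR // ler0n.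
  rewrite -[leLHS]E0.
  apply: (hM _ _ _ hW); split.
    have [] := nball_lin hB (- z) hW (nball_S_op d0 d2 p01 hB hW).
    move=> + _; congr c0_seq; apply/funext => n.
    by rewrite mulNr addrC.
  move=> n; apply: le_trans (hd K n); rewrite le_eqVlt; apply/orP; left.
  by rewrite S_op_sum /W mulr_sumr -sumrB.
(* [WK] gives [K <= M * (1 + J) + K / 2], which fails for such a [K]. *)
have [K hK] : exists K : nat, 2 * (M + 1) * (1 + J%:R) + 1 <= K%:R.
  by exists (Num.truncn (2 * (M + 1) * (1 + J%:R) + 1)).+1; rewrite ltW // truncnS_gt.
have := WK K; rewrite leNgt => /negP; apply.
have Me : M * e <= 2^-1.
  rewrite /e invfM mulrCA ler_piMr ?invr_ge0 // ler_pdivrMr // mul1r.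
  by rewrite lerDl.
have J0 : 0 <= J%:R :> R by [].
have K0 : 0 <= K%:R :> R by [].
have := ler_wpM2r K0 Me.
have -> : M * (1 + J%:R + K%:R * e) = M * (1 + J%:R) + M * e * K%:R by ring.
by move=> h; lra.
Qed.

Lemma c_ball_c0 (C : R) (w : nat -> R[i]) : c_ball C w -> exists2 l,
  cmod l <= C & c0_ball (C + C) (fun n => w n - l).
Proof.
move=> [/c_seqP[l hl] wC]; have lC : cmod l <= C.
  apply/ler_addgt0Pr => e /hl[N /(_ N (leqnn N))]; rewrite cmodB => h.
  rewrite -(subrK (w N) l) addrC (le_trans (ler_cmodD _ _)) // lerD //.
exists l => //; split=> [|n]; first by apply/c0_seqP => e /hl.
by rewrite (le_trans (ler_cmodD _ _)) // cmodN lerD.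
Qed.

Lemma c0_ball_c (C : R) (w : nat -> R[i]) l : c0_ball C w ->
  c_ball (C + cmod l) (fun n => w n + l).
Proof.
move=> [/c0_seqP w0 wC]; split=> [|n].
  by apply/c_seqP; exists l => e /w0[N hN]; exists N => n /hN; rewrite addrK.
by rewrite (le_trans (ler_cmodD _ _)) // lerD2r.
Qed.

Lemma c_ball_lin (a : R[i]) (C C' : R) (w w' : nat -> R[i]) : c_ball C w ->
  c_ball C' w' -> exists D, c_ball D (fun n => a * w n + w' n).
Proof.
move=> /c_ball_c0[l _ hw] /c_ball_c0[l' _ hw'].
have := c0_ball_c (a * l + l') (nball_lin (@c0_ball_space R) a hw hw').
set D := (X in c_ball X) => h; exists D; move: h; congr c_ball.
by apply/funext => n; ring.
Qed.

Lemma c_ball_S_op (C : R) w : c_ball C w -> c_ball C (S_op d p w).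
Proof.
move=> hw; split=> [|n]; last by apply: cmod_S_op_le => // m; case: hw.
have [l _ /(nball_S_op d0 d2 p01 (@c0_ball_space R))/(c0_ball_c l)[+ _]] := c_ball_c0 hw.
congr c_seq; apply/funext => n.
have -> : (fun n => w n - l) = (fun n => 1 * w n + - l).
  by apply/funext => m; rewrite mul1r.
by rewrite S_op_lin S_op_const // mul1r subrK.
Qed.

(** [S] fixes constants, so a limit [l] on the right is matched by adding the constant
    [l / (1 - z)]. An eigenvector with limit [l] satisfies [(1 - z) * l = 0], hence lies in c_0. *)
Lemma invertible_c_ball z : z != 1 -> invertible_at d p (@c0_ball R) z ->
  invertible_at d p (@c_ball R) z.
Proof.
move=> z1 [M M0 [solve inj]].
have z1' : 1 - z != 0 by rewrite subr_eq0 eq_sym.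
have Sc w l n : S_op d p (fun n => w n + l) n = S_op d p w n + l.
  have -> : (fun n => w n + l) = (fun n => 1 * w n + l).
    by apply/funext => m; rewrite mul1r.
  by rewrite S_op_lin S_op_const // mul1r.
exists (M * 2 + cmod (1 - z)^-1) => [|].
  by rewrite addr_ge0 ?mulr_ge0 ?cmod_ge0.
split=> [C y hy|C x hx xz n].
  have [l lC /solve[x hx xE]] := c_ball_c0 hy.
  have [xc xb] := c0_ball_c (l / (1 - z)) hx.
  exists (fun n => x n + l / (1 - z)) => [|n].
    split=> // n; rewrite (le_trans (xb n)) // mulrDl lerD //.
      by rewrite -mulrA mulr_natl mulr2n.
    by rewrite cmodM mulrC ler_wpM2l ?cmod_ge0.
  rewrite Sc -(subrK l (y n)) -xE.
  by field.
have [l _ hxl] := c_ball_c0 hx.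
have xE m : S_op d p (fun n => x n - l) m - z * (x m - l) = - ((1 - z) * l).
  by rewrite Sc xz; ring.
have [/c0_seqP h0 _] := nball_lin (@c0_ball_space R) (- z) hxl
  (nball_S_op d0 d2 p01 (@c0_ball_space R) hxl).
have l0 : l = 0.
  apply/eqP; have : (1 - z) * l = 0.
    apply: cmod_small => e /h0[N /(_ N (leqnn N))].
    by rewrite mulNr addrC xE cmodN.
  by move/eqP; rewrite mulf_eq0 (negbTE z1').
have -> : x n = x n - l by rewrite l0 subr0.
apply: (inj _ _ hxl) => m; have := xE m.
by rewrite l0 mulr0 oppr0 => /eqP; rewrite subr_eq0 => /eqP.
Qed.

(** Each [f] fixes 1, so points outside [E] differ from 1, as the passage from c_0 to c requires. *)
Lemma ftilde1 j : ftilde d p j 1 = 1.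
Proof.
elim: j => //= j ->; have /andP[p0 _] := p01 (ltn0Sn j).
have P : (p j.+1)%:C != 0 by rewrite -cmod_eq0 cmodR normr_eq0 gt_eqF.
by rewrite /f rmorphB opprB addrC subrK divff // expr1n.
Qed.

Lemma not_EP z : ~ E d p z -> exists j, 1 < cmod (ftilde d p j z).
Proof.
move=> /(contra_not (EP d2 p01 z).2)/existsNP[j /negP]; rewrite -ltNge.
by exists j.
Qed.

End Invertibility.

Theorem theorem4p1 (R : realType) (d : nat -> nat) (p : nat -> R)
    (d0 : d 0%N = 1%N)
    (d2 : forall j : nat, (1 <= j)%N -> (2 <= d j)%N)
    (p01 : forall j : nat, (1 <= j)%N -> 0 < p j <= 1) :
  spectrum c0_seq sup_norm (S_op d p) = E d p /\
  spectrum c_seq sup_norm (S_op d p) = E d p /\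
  (forall alpha : R, 1 <= alpha ->
     spectrum (l_seq alpha) (l_norm alpha) (S_op d p) = E d p).
Proof.
have c_ge0 (C : R) w : c_ball C w -> 0 <= C.
  by move=> [_ /(_ 0%N)]; apply: le_trans; exact: cmod_ge0.
have main V N B : ball_space B -> norm_balls V N B ->
    (forall z, E d p z -> ~ exists2 M, 0 <= M & forall C' C x, B C' x ->
      B C (fun n => S_op d p x n - z * x n) -> B (M * C) x) ->
    spectrum V N (S_op d p) = E d p.
  move=> hB hN nb; apply/seteqP; split=> z.
    apply: contraPP => /(not_EP d2 p01)[j /(invertible_at_ftilde hB d0 d2 p01) hz].
    apply: (not_spectrum_of_invertible hN _ _ _ hz) => [C w|a C C' w w' hw hw'|C w].
    - exact: nball_ge0.
    - by exists (cmod a * C + C'); exact: nball_lin.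
    - exact: nball_S_op.
  move=> zE; apply: contrapT => h; apply: (nb z zE).
  by apply: (bounded_below_of_not_spectrum hN _ h) => C w; exact: nball_ge0.
split; [|split].
- apply: main c0_norm_balls _ => [|z /c0_ball_not_bounded_below].
    exact: c0_ball_space.
  move=> /(_ d0 d2 p01) nb [M M0 hM]; apply: nb; exists M => // C' C x hx hy.
  by have [] := hM _ _ _ hx hy.
(* The balls of c form no [ball_space]: gluing residues with different limits destroys convergence.
   Both inclusions go through c_0. *)
- apply/seteqP; split=> z.
    apply: contraPP => /(not_EP d2 p01)[j zj].
    have z1 : z != 1.
      by apply/eqP => e; move: zj; rewrite e ftilde1 // cmod1 ltxx.
    have hz := invertible_c_ball d0 d2 p01 z1
      (invertible_at_ftilde (@c0_ball_space R) d0 d2 p01 zj).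
    apply: (not_spectrum_of_invertible c_norm_balls _ _ _ hz) => //.
    + exact: c_ball_lin.
    + by move=> C w; exact: c_ball_S_op.
  move=> zE; apply: contrapT => h; apply: (c0_ball_not_bounded_below d0 d2 p01 zE).
  have [M M0 hM] := bounded_below_of_not_spectrum c_norm_balls c_ge0 h.
  exists M => // C' C x [/c0_seq_c xc xC] [/c0_seq_c yc yC].
  by have [] := hM C' C x (conj xc xC) (conj yc yC).
- move=> alpha a1; apply: main (l_norm_balls a1) _; first exact: l_ball_space.
  by move=> z; exact: l_ball_not_bounded_below.
Qed.
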